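(* Let $K$ be an algebraically closed field of characteristic zero and let $q\in K\setminus\{0\}$ not be a root of unity. Let $\theta_x\in\{\sigma_x,\tau_{q,x}\}$ and $\theta_y\in\{\sigma_y,\tau_{q,y}\}$, and set $\partial_x=\theta_x-1$, $\partial_y=\theta_y-1$ (so $\partial_x\in\{\Delta_x,\Delta_{q,x}\}$, $\partial_y\in\{\Delta_y,\Delta_{q,y}\}$). Let $f,g\in K(x,y)$ satisfy $\partial_x(f)=\partial_y(g)$. Then there exist rational functions $a,b_1,\dots,b_n\in K(x,y)$ such that \[ f=\partial_y(a)+\sum_{i=1}^n\frac{\theta_x^{s_i}-1}{\theta_x-1}\bullet b_i\quad\text{and}\quad g=\partial_x(a)+\sum_{i=1}^n\frac{\theta_y^{t_i}-1}{\theta_y-1}\bullet b_i, \] where for each $i\in\{1,\dots,n\}$ we have $\theta_x^{s_i}(b_i)=\theta_y^{t_i}(b_i)$ for some $s_i\in\mathbb{N}$ and $t_i\in\mathbb{Z}$, not both zero.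
   Context: $\sigma_x(f(x,y))=f(x+1,y)$, $\sigma_y(f(x,y))=f(x,y+1)$, $\tau_{q,x}(f(x,y))=f(qx,y)$, $\tau_{q,y}(f(x,y))=f(x,qy)$ on $K(x,y)$. For an operator $\theta$ and $n\in\mathbb{Z}$, $\frac{\theta^n-1}{\theta-1}$ denotes $\sum_{j=0}^{n-1}\theta^j$ if $n\ge 0$ and $-\sum_{j=1}^{-n}\theta^{-j}$ if $n<0$; $\bullet$ denotes its action on $K(x,y)$. *)

(* Defs.v *)
From HB Require Import structures.
From mathcomp Require Import all_boot all_order all_algebra.

Set Implicit Arguments.
Unset Strict Implicit.
Unset Printing Implicit Defensive.

Import GRing.Theory.
Local Open Scope ring_scope.

(* K(x,y); as in polyXY, x is the outer variable 'X and y the inner one 'Y. *)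
Notation "{ 'ratfun' K }" := {fraction {poly {poly K}}}
  (at level 0, K at level 60, format "{ 'ratfun'  K }") : type_scope.

Section RationalFunctions.
Variable K : fieldType.
Implicit Types (a b c : K) (p d U : {poly {poly K}}) (f u v : {ratfun K}).

Definition rcst c : {ratfun K} := FracField.tofrac c%:P%:P.
Lemma rcst_zmod : zmod_morphism rcst.
Proof. by move=> a b; rewrite /rcst !rmorphB. Qed.
Lemma rcst_monoid : monoid_morphism rcst.
Proof. by split=> [|a b]; rewrite /rcst ?rmorph1 // !rmorphM. Qed.
HB.instance Definition _ :=
  GRing.isZmodMorphism.Build K {ratfun K} rcst rcst_zmod.
HB.instance Definition _ :=
  GRing.isMonoidMorphism.Build K {ratfun K} rcst rcst_monoid.

Definition rx : {ratfun K} := FracField.tofrac 'X.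
Definition ry : {ratfun K} := FracField.tofrac 'Y.

Definition bieval u v p : {ratfun K} :=
  (map_poly (map_poly rcst) p).[u, v].

(* f(u,v).  As x / 0 = 0, this is meaningful only if bieval u v does not kill
   the denominator of f; see rsubst_frac for the substitutions used below. *)
Definition rsubst u v f : {ratfun K} :=
  bieval u v \n_(repr f) / bieval u v \d_(repr f).

Lemma bieval_zmod u v : zmod_morphism (bieval u v).
Proof. by move=> p d; rewrite /bieval !(rmorphB, hornerE). Qed.
Lemma bieval_monoid u v : monoid_morphism (bieval u v).
Proof.
by split=> [|p d]; rewrite /bieval ?rmorph1 ?hornerE // rmorphM !hornerM.
Qed.
HB.instance Definition _ u v :=
  GRing.isZmodMorphism.Build _ _ (bieval u v) (bieval_zmod u v).
HB.instance Definition _ u v :=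
  GRing.isMonoidMorphism.Build _ _ (bieval u v) (bieval_monoid u v).

Lemma bievalC u v c : bieval u v c%:P%:P = rcst c.
Proof. by rewrite /bieval !map_polyC /= ?map_polyC !hornerC. Qed.
Lemma bievalX u v : bieval u v 'X = u.
Proof. by rewrite /bieval map_polyX hornerX hornerC. Qed.
Lemma bievalY u v : bieval u v 'Y = v.
Proof. by rewrite /bieval map_polyC hornerC /= map_polyX hornerX. Qed.

Lemma bieval_unique (g : {rmorphism {poly {poly K}} -> {ratfun K}}) :
  (forall c, g c%:P%:P = rcst c) -> g =1 bieval (g 'X) (g 'Y).
Proof.
move=> gC p; elim/poly_ind: p => [|p a IHp]; first by rewrite !rmorph0.
rewrite !rmorphD !rmorphM IHp /= bievalX; congr (_ + _).
elim/poly_ind: a => [|a c IHa]; first by rewrite !rmorph0.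
by rewrite polyCD polyCM !rmorphD !rmorphM IHa /= bievalY gC bievalC.
Qed.

Lemma bieval_xy p : bieval rx ry p = FracField.tofrac p.
Proof. by rewrite -(@bieval_unique (@FracField.tofrac _)). Qed.

Lemma ratfun_repr f :
  f = FracField.tofrac \n_(repr f) / FracField.tofrac \d_(repr f).
Proof.
have d0 : FracField.tofrac \d_(repr f) != 0.
  by rewrite tofrac_eq0 denom_ratioP.
apply: (mulIf d0); rewrite divfK // -[X in X * _ = _]reprK.
move: (repr f) => r; unlock FracField.tofrac; rewrite -[LHS]FracField.pi_mul.
apply/eqmodP; rewrite /= FracField.equivfE /FracField.mulf.
by rewrite !numden_Ratio ?mulf_neq0 ?oner_neq0 ?denom_ratioP // !mulr1 mulrC.
Qed.

Section Injective.
Variables u v : {ratfun K}.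
Hypothesis inj_uv : injective (bieval u v).

Lemma bieval_eq0 p : (bieval u v p == 0) = (p == 0).
Proof. by rewrite -(rmorph0 (bieval u v)) (inj_eq inj_uv). Qed.

Lemma rsubst_frac p d : d != 0 ->
  rsubst u v (FracField.tofrac p / FracField.tofrac d)
    = bieval u v p / bieval u v d.
Proof.
move=> d0; set f := _ / _; have := ratfun_repr f; rewrite /rsubst.
have := denom_ratioP (repr f).
move: (\n_(repr f)) (\d_(repr f)) => n e e0 /eqP.
rewrite /f eqr_div ?tofrac_eq0 // -!rmorphM tofrac_eq => /eqP E.
by apply/eqP; rewrite eqr_div ?bieval_eq0 // -!rmorphM -E.
Qed.

Lemma rsubst_tofrac p : rsubst u v (FracField.tofrac p) = bieval u v p.
Proof.
rewrite -[FracField.tofrac p]divr1 -(rmorph1 (@FracField.tofrac _)).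
by rewrite rsubst_frac ?oner_neq0 // rmorph1 divr1.
Qed.

Lemma rsubst_zmod : zmod_morphism (rsubst u v).
Proof.
move=> f g; rewrite [f]ratfun_repr [g]ratfun_repr.
move: (denom_ratioP (repr f)) (denom_ratioP (repr g)).
move: (\n_(repr f)) (\d_(repr f)) (\n_(repr g)) (\d_(repr g)) => a b c d b0 d0.
rewrite -mulNr addf_div ?tofrac_eq0 // -rmorphN -!rmorphM -rmorphD.
rewrite !rsubst_frac ?mulf_neq0 // -mulNr addf_div ?bieval_eq0 //.
by rewrite rmorphD !rmorphM rmorphN.
Qed.

Lemma rsubst_monoid : monoid_morphism (rsubst u v).
Proof.
split=> [|f g].
  by rewrite -[X in rsubst _ _ X](rmorph1 (@FracField.tofrac {poly {poly K}})) rsubst_tofrac rmorph1.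
rewrite [f]ratfun_repr [g]ratfun_repr.
move: (denom_ratioP (repr f)) (denom_ratioP (repr g)).
move: (\n_(repr f)) (\d_(repr f)) (\n_(repr g)) (\d_(repr g)) => a b c d b0 d0.
rewrite mulf_div -!rmorphM !rsubst_frac ?mulf_neq0 //.
by rewrite mulf_div -!rmorphM.
Qed.

Lemma rsubst_comp u' v' : rsubst u v u' = rx -> rsubst u v v' = ry ->
  cancel (rsubst u' v') (rsubst u v).
Proof.
pose sA := GRing.isZmodMorphism.Build _ _ _ rsubst_zmod.
pose sM := GRing.isMonoidMorphism.Build _ _ _ rsubst_monoid.
pose s : {rmorphism {ratfun K} -> {ratfun K}} := HB.pack (rsubst u v) sA sM.
move=> ux vy f; have E p : s (bieval u' v' p) = FracField.tofrac p.
  pose g : {rmorphism {poly {poly K}} -> {ratfun K}} := s \o bieval u' v'.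
  rewrite -[LHS]/(g p) (@bieval_unique g) => [|c].
    by rewrite /g /= bievalX bievalY /= ux vy bieval_xy.
  by rewrite /g /= bievalC rsubst_tofrac bievalC.
by rewrite -[LHS]/(s (_ / _)) fmorph_div !E -ratfun_repr.
Qed.
End Injective.

Lemma bieval_comp_x U p :
  bieval (FracField.tofrac U) ry p = FracField.tofrac (p \Po U).
Proof.
pose g : {rmorphism {poly {poly K}} -> {ratfun K}} :=
  @FracField.tofrac _ \o comp_poly U.
rewrite -[RHS]/(g p) (@bieval_unique g) => [|c]; last by rewrite /g /= comp_polyC.
by rewrite /g /= comp_polyX comp_polyC.
Qed.

Lemma bieval_comp_y (V : {poly K}) p :
  bieval rx (FracField.tofrac V%:P) p
    = FracField.tofrac (map_poly (comp_poly V) p).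
Proof.
pose g : {rmorphism {poly {poly K}} -> {ratfun K}} :=
  @FracField.tofrac _ \o map_poly (comp_poly V).
rewrite -[RHS]/(g p) (@bieval_unique g) => [|c].
  by rewrite /g /= map_polyX map_polyC /= comp_polyX.
by rewrite /g /= map_polyC /= comp_polyC.
Qed.

Lemma bieval_inj_x U : size U = 2 -> injective (bieval (FracField.tofrac U) ry).
Proof.
move=> sU; apply: raddf_inj => p; rewrite /= bieval_comp_x => /eqP.
by rewrite tofrac_eq0 comp_poly2_eq0 // => /eqP.
Qed.

Lemma bieval_inj_y (V : {poly K}) :
  size V = 2 -> injective (bieval rx (FracField.tofrac V%:P)).
Proof.
move=> sV; apply: raddf_inj => p; rewrite /= bieval_comp_y => /eqP.
rewrite tofrac_eq0; case: (eqVneq p 0) => [->//|p0].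
rewrite map_poly_eq0_id0; first by move/eqP->.
by rewrite comp_poly2_eq0 // lead_coef_eq0.
Qed.

Lemma affine_inj_x a b : a != 0 -> injective (bieval (rcst a * rx + rcst b) ry).
Proof.
move=> a0; rewrite /rx /rcst /= -rmorphM -rmorphD; apply: bieval_inj_x.
rewrite size_MXaddC polyC_eq0 polyC_eq0 (negPf a0) /=.
by rewrite size_polyC polyC_eq0 a0.
Qed.

Lemma affine_inj_y a b : a != 0 -> injective (bieval rx (rcst a * ry + rcst b)).
Proof.
move=> a0; rewrite /ry /rcst /= -rmorphM -rmorphD -polyCM -polyCD.
apply: bieval_inj_y; rewrite size_MXaddC polyC_eq0 (negPf a0) /=.
by rewrite size_polyC a0.
Qed.

Lemma affineK_x a b a' b' : a != 0 -> a * a' = 1 -> a' * b + b' = 0 ->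
  cancel (rsubst (rcst a' * rx + rcst b') ry) (rsubst (rcst a * rx + rcst b) ry).
Proof.
move=> a0 aa' b0; have I := @affine_inj_x a b a0.
apply: rsubst_comp => //; last by rewrite rsubst_tofrac ?bievalY.
have -> : rcst a' * rx + rcst b'
    = FracField.tofrac (a'%:P%:P * 'X + b'%:P%:P) by rewrite rmorphD rmorphM.
rewrite rsubst_tofrac // rmorphD rmorphM /=.
rewrite !bievalC bievalX mulrDr mulrA -addrA.
have -> : rcst a' * rcst a = 1 by rewrite -rmorphM mulrC aa' rmorph1.
have -> : rcst a' * rcst b + rcst b' = 0 by rewrite -rmorphM -rmorphD b0 rmorph0.
by rewrite mul1r addr0.
Qed.

Lemma affineK_y a b a' b' : a != 0 -> a * a' = 1 -> a' * b + b' = 0 ->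
  cancel (rsubst rx (rcst a' * ry + rcst b')) (rsubst rx (rcst a * ry + rcst b)).
Proof.
move=> a0 aa' b0; have I := @affine_inj_y a b a0.
apply: rsubst_comp => //; first by rewrite rsubst_tofrac ?bievalX.
have -> : rcst a' * ry + rcst b'
    = FracField.tofrac (a'%:P%:P * 'Y + b'%:P%:P) by rewrite rmorphD rmorphM.
rewrite rsubst_tofrac // rmorphD rmorphM /=.
rewrite !bievalC bievalY mulrDr mulrA -addrA.
have -> : rcst a' * rcst a = 1 by rewrite -rmorphM mulrC aa' rmorph1.
have -> : rcst a' * rcst b + rcst b' = 0 by rewrite -rmorphM -rmorphD b0 rmorph0.
by rewrite mul1r addr0.
Qed.

(* Bundled with the inverse so that theta^n makes sense for n < 0. *)
Record operator := Operator {
  op :> {ratfun K} -> {ratfun K};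
  op_inv : {ratfun K} -> {ratfun K};
  opK : cancel op op_inv;
  op_invK : cancel op_inv op }.

Lemma shiftE_x : rx + 1 = rcst 1 * rx + rcst 1.
Proof. by rewrite rmorph1 mul1r. Qed.
Lemma shift_invE_x : rx - 1 = rcst 1 * rx + rcst (- 1).
Proof. by rewrite rmorphN !rmorph1 mul1r. Qed.

Lemma sigma_xK : cancel (rsubst (rx + 1) ry) (rsubst (rx - 1) ry).
Proof.
rewrite shiftE_x shift_invE_x.
by apply: affineK_x; rewrite ?oner_neq0 ?mul1r ?addNr.
Qed.
Lemma sigma_x_invK : cancel (rsubst (rx - 1) ry) (rsubst (rx + 1) ry).
Proof.
rewrite shiftE_x shift_invE_x.
by apply: affineK_x; rewrite ?oner_neq0 ?mul1r ?addrN.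
Qed.
Definition sigma_x := Operator sigma_xK sigma_x_invK.

Lemma shiftE_y : ry + 1 = rcst 1 * ry + rcst 1.
Proof. by rewrite rmorph1 mul1r. Qed.
Lemma shift_invE_y : ry - 1 = rcst 1 * ry + rcst (- 1).
Proof. by rewrite rmorphN !rmorph1 mul1r. Qed.

Lemma sigma_yK : cancel (rsubst rx (ry + 1)) (rsubst rx (ry - 1)).
Proof.
rewrite shiftE_y shift_invE_y.
by apply: affineK_y; rewrite ?oner_neq0 ?mul1r ?addNr.
Qed.
Lemma sigma_y_invK : cancel (rsubst rx (ry - 1)) (rsubst rx (ry + 1)).
Proof.
rewrite shiftE_y shift_invE_y.
by apply: affineK_y; rewrite ?oner_neq0 ?mul1r ?addrN.
Qed.
Definition sigma_y := Operator sigma_yK sigma_y_invK.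

Section QShift.
Variables (q : K) (q0 : q != 0).

Lemma tau_xK : cancel (rsubst (rcst q * rx) ry) (rsubst (rcst q^-1 * rx) ry).
Proof.
have := @affineK_x q^-1 0 q 0; rewrite (rmorph0 rcst) !addr0.
by apply=> //; rewrite ?invr_eq0 ?mulVf ?mulr0.
Qed.
Lemma tau_x_invK : cancel (rsubst (rcst q^-1 * rx) ry) (rsubst (rcst q * rx) ry).
Proof.
have := @affineK_x q 0 q^-1 0; rewrite (rmorph0 rcst) !addr0.
by apply=> //; rewrite ?mulfV ?mulr0.
Qed.
Definition tau_x := Operator tau_xK tau_x_invK.

Lemma tau_yK : cancel (rsubst rx (rcst q * ry)) (rsubst rx (rcst q^-1 * ry)).
Proof.
have := @affineK_y q^-1 0 q 0; rewrite (rmorph0 rcst) !addr0.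
by apply=> //; rewrite ?invr_eq0 ?mulVf ?mulr0.
Qed.
Lemma tau_y_invK : cancel (rsubst rx (rcst q^-1 * ry)) (rsubst rx (rcst q * ry)).
Proof.
have := @affineK_y q 0 q^-1 0; rewrite (rmorph0 rcst) !addr0.
by apply=> //; rewrite ?mulfV ?mulr0.
Qed.
Definition tau_y := Operator tau_yK tau_y_invK.
End QShift.

Implicit Types (theta : operator) (n : int).

Definition op_pow theta n f : {ratfun K} :=
  match n with
  | Posz m => iter m theta f
  | Negz m => iter m.+1 (op_inv theta) f
  end.

Definition partial theta f : {ratfun K} := theta f - f.

(* (theta^n - 1) / (theta - 1) applied to f; Negz m is - m.+1. *)
Definition op_quot theta n f : {ratfun K} :=
  match n with
  | Posz m => \sum_(0 <= j < m) op_pow theta j%:Z f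
  | Negz m => - \sum_(1 <= j < m.+2) op_pow theta (- j%:Z) f
  end.
End RationalFunctions.

Arguments sigma_x {K}.
Arguments sigma_y {K}.

(* Main.v *)
(* Modulo the image of theta_x - 1, the hypothesis says that g is fixed by
   theta_y.  View K(x,y) as L(x) with L = K(y).  For a place d of L[x] with
   infinite theta_x-orbit, transporting the polar parts of g along this orbit to
   d and adding them up gives a trace of g at d which vanishes on the image of
   theta_x - 1 and commutes with theta_y.  If the trace b at d is nonzero then, g
   having finitely many poles, some theta_y^t d with t > 0 minimal lies in the
   theta_x-orbit of d, say as theta_x^s d; hence theta_y^t b = theta_x^s b, and
   subtracting b + theta_y b + ... + theta_y^(t-1) b from g removes the traces
   along this double orbit.  When all traces vanish, so do the polar parts modulo
   the image of theta_x - 1, and what is left is a polynomial, which has an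
   antidifference, in the shift case, and a Laurent polynomial in the q-shift
   case, where only its constant term, fixed by theta_y, matters. *)

Require Import Defs.
From HB Require Import structures.
From Stdlib Require Import Classical ClassicalEpsilon FunctionalExtensionality.
From Stdlib Require List.
From mathcomp Require Import all_boot all_order all_algebra.
From mathcomp Require Import ring.

Set Implicit Arguments.
Unset Strict Implicit.
Unset Printing Implicit Defensive.

Import GRing.Theory.
Local Open Scope ring_scope.

(** * Coinvariants of two commuting automorphisms *)

Lemma addrBBC (V : zmodType) (a b c d : V) : a - b - (c - d) = a - c - (b - d).
Proof. by rewrite !opprB addrACA [RHS]addrACA [- b - c]addrC. Qed.

Lemma addrBACA3 (V : zmodType) (a b c d e f : V) :
  a - b + (c - d + (e - f)) = a + (c + e) - (b + (d + f)).
Proof. by rewrite !opprD [RHS]addrACA; congr (_ + _); exact: addrACA. Qed.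

Lemma addr_telescope (V : zmodType) (a b c d : V) :
  a - b + (c - a + (b - d)) = c - d.
Proof. by rewrite addrC addrAC !subrKA. Qed.

Section AdditiveMaps.
Variables (U V : zmodType) (h : U -> V).
Hypothesis h_zm : zmod_morphism h.
Let hA : {additive U -> V} :=
  HB.pack h (GRing.isZmodMorphism.Build _ _ h h_zm).

Lemma zmB u v : h (u - v) = h u - h v. Proof. exact: h_zm. Qed.
Lemma zm0 : h 0 = 0. Proof. exact: (raddf0 hA). Qed.
Lemma zmN u : h (- u) = - h u. Proof. exact: (raddfN hA). Qed.
Lemma zmD u v : h (u + v) = h u + h v. Proof. exact: (raddfD hA). Qed.
Lemma zm_sum n (E : 'I_n -> U) : h (\sum_i E i) = \sum_i h (E i).
Proof. exact: (raddf_sum hA). Qed.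
End AdditiveMaps.

Lemma iter_zm (V : zmodType) (h : V -> V) k :
  zmod_morphism h -> zmod_morphism (iter k h).
Proof. by move=> hz; elim: k => [|k IH] u v //=; rewrite IH hz. Qed.

Lemma can_zm (V : zmodType) (h h' : V -> V) :
  zmod_morphism h -> cancel h h' -> cancel h' h -> zmod_morphism h'.
Proof. by move=> hz hK h'K u v; apply: (can_inj hK); rewrite h'K hz !h'K. Qed.

Lemma iterK (T : Type) (h h' : T -> T) k :
  cancel h h' -> cancel (iter k h) (iter k h').
Proof. by move=> hK; elim: k => [|k IH] v //; rewrite iterSr /= hK IH. Qed.

(** An element of [s] is related to at most one index, so its finitely many elements rule out only
    finitely many indices. This lets the finiteness of the set of poles act on infinite orbits. *)
Lemma eventually_unrelated (T : Type) (R : nat -> T -> Prop) (s : seq T) :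
  (forall i j a, R i a -> R j a -> i = j) ->
  exists N, forall k, (N <= k)%N -> forall a, List.In a s -> ~ R k a.
Proof.
move=> Ri; elim: s => [|a s [N HN]]; first by exists 0.
case: (classic (exists j, R j a)) => [[j Rj]|Hj]; last first.
  by exists N => k /HN Hk a' [<- Rk|/Hk//]; case: Hj; exists k.
exists (maxn N j.+1) => k; rewrite geq_max => /andP[/HN Hk jk] a' [<- Rk|/Hk//].
by rewrite (Ri _ _ _ Rk Rj) ltnn in jk.
Qed.

Lemma inj_leaves_seq (T : Type) (c : nat -> T) (s : seq T) : injective c ->
  exists N, forall k, (N <= k)%N -> ~ List.In (c k) s.
Proof.
move=> ci; have [i j a -> /ci //|N HN] :=
  @eventually_unrelated _ (fun k a => a = c k) s.
by exists N => k /HN Hk /Hk.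
Qed.

Lemma ex_min_pos (R : nat -> Prop) n : (0 < n)%N -> R n ->
  exists t, [/\ (0 < t)%N, R t & forall j, (0 < j < t)%N -> ~ R j].
Proof.
elim/ltn_ind: n => n IH n0 Rn.
case: (classic (exists2 j, (0 < j < n)%N & R j)) => [[j /andP[j0 jn] Rj]|H].
  exact: (IH j).
by exists n; split=> // j jn Rj; apply: H; exists j.
Qed.

Section Coinvariants.
Variables (V : zmodType) (X X' Y Y' : V -> V).
Hypotheses (X_zm : zmod_morphism X) (Y_zm : zmod_morphism Y).
Hypotheses (XK : cancel X X') (X'K : cancel X' X).
Hypotheses (YK : cancel Y Y') (Y'K : cancel Y' Y).
Hypothesis XYC : forall v, X (Y v) = Y (X v).
Implicit Types (u v w b h : V) (p : V -> V) (k l m n t : nat).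

Let X'_zm : zmod_morphism X'. Proof. exact: can_zm XK X'K. Qed.

Let X'YC v : X' (Y v) = Y (X' v).
Proof. by rewrite -{1}[v]X'K -XYC XK. Qed.

Let iXYC k l v : iter k X (iter l Y v) = iter l Y (iter k X v).
Proof.
elim: k v => [//|k IH] v; rewrite !iterSr -IH; congr iter.
by elim: l {IH} => //= l IHl; rewrite XYC IHl.
Qed.
Let iX'YC k l v : iter k X' (iter l Y v) = iter l Y (iter k X' v).
Proof.
elim: k v => [//|k IH] v; rewrite !iterSr -IH; congr iter.
by elim: l {IH} => //= l IHl; rewrite X'YC IHl.
Qed.

(** Conjugation is the action on places: if [p] takes polar parts at a place, then [xconj k p] takes
    them at the image of this place under the k-th power of [X]. *)
Definition xconj k p v := iter k X (p (iter k X' v)).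
Definition yconj k p v := iter k Y (p (iter k Y' v)).

Definition x'conj k p v := iter k X' (p (iter k X v)).

Lemma x'conjK k p : xconj k (x'conj k p) = p.
Proof.
apply: functional_extensionality => v; rewrite /xconj /x'conj.
by rewrite !(iterK _ X'K).
Qed.

Lemma xconjD k l p : xconj (k + l) p = xconj k (xconj l p).
Proof.
by apply: functional_extensionality => v; rewrite /xconj iterD addnC iterD.
Qed.
Lemma yconjD k l p : yconj (k + l) p = yconj k (yconj l p).
Proof.
by apply: functional_extensionality => v; rewrite /yconj iterD addnC iterD.
Qed.

Lemma xconj_intertwine k p v : xconj k p (iter k X v) = iter k X (p v).
Proof. by rewrite /xconj (iterK _ XK). Qed.
Lemma yconj_intertwine k p v : yconj k p (iter k Y v) = iter k Y (p v).
Proof. by rewrite /yconj (iterK _ YK). Qed.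

Lemma xconj_inj k : injective (xconj k).
Proof.
move=> p1 p2 E; apply: functional_extensionality => v.
by apply: (can_inj (iterK k XK)); rewrite -!xconj_intertwine E.
Qed.
Lemma yconj_inj k : injective (yconj k).
Proof.
move=> p1 p2 E; apply: functional_extensionality => v.
by apply: (can_inj (iterK k YK)); rewrite -!yconj_intertwine E.
Qed.

Lemma xyconjC k l p : xconj k (yconj l p) = yconj l (xconj k p).
Proof.
apply: functional_extensionality => v; rewrite /xconj /yconj iXYC.
congr (iter l Y (iter k X (p _))); apply: (can_inj (iterK l YK)).
by rewrite -iX'YC !(iterK l Y'K).
Qed.

(* Both conjugations are by nonnegative powers, to keep the relation
   manifestly symmetric. *)
Definition xequiv p1 p2 := exists k l, xconj k p1 = xconj l p2.

Lemma xequiv_sym p1 p2 : xequiv p1 p2 -> xequiv p2 p1.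
Proof. by case=> k [l E]; exists l, k. Qed.
Lemma xequiv_trans p1 p2 p3 : xequiv p1 p2 -> xequiv p2 p3 -> xequiv p1 p3.
Proof.
case=> k [l E] [m [n E']]; exists (m + k)%N, (l + n)%N.
by rewrite !xconjD E -E' -!xconjD addnC.
Qed.
Lemma xequiv_yconj m p1 p2 :
  xequiv (yconj m p1) (yconj m p2) -> xequiv p1 p2.
Proof. by case=> k [l]; rewrite !xyconjC => /yconj_inj E; exists k, l. Qed.

(* Members of P stand for the projections onto polar parts at the places with
   infinite X-orbit. *)
Variable P : (V -> V) -> Prop.
Hypothesis P_zm : forall p, P p -> zmod_morphism p.
Hypothesis P_idem : forall p, P p -> forall v, p (p v) = p v.
Hypothesis P_orth :
  forall p1 p2, P p1 -> P p2 -> p1 <> p2 -> forall v, p1 (p2 v) = 0.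
Hypothesis P_x : forall p, P p -> P (X \o p \o X').
Hypothesis P_x' : forall p, P p -> P (X' \o p \o X).
Hypothesis P_y : forall p, P p -> P (Y \o p \o Y').
Hypothesis P_free : forall p k, P p -> (0 < k)%N -> xconj k p <> p.
Hypothesis P_fin : forall v, exists s : seq (V -> V),
  forall p, P p -> p v <> 0 -> List.In p s.

Lemma P_xconj k p : P p -> P (xconj k p).
Proof.
move=> Pp; elim: k => [//|k IH]; suff -> : xconj k.+1 p = X \o xconj k p \o X'.
  exact: P_x.
by apply: functional_extensionality => v; rewrite /xconj /= -iterSr.
Qed.
Lemma P_yconj k p : P p -> P (yconj k p).
Proof.
move=> Pp; elim: k => [//|k IH]; suff -> : yconj k.+1 p = Y \o yconj k p \o Y'.
  exact: P_y.
by apply: functional_extensionality => v; rewrite /yconj /= -iterSr.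
Qed.
Lemma P_x'conj k p : P p -> P (x'conj k p).
Proof.
move=> Pp; elim: k => [//|k IH].
suff -> : x'conj k.+1 p = X' \o x'conj k p \o X by exact: P_x'.
by apply: functional_extensionality => v; rewrite /x'conj /= -iterSr.
Qed.


Lemma xconj_nat_inj p : P p -> injective (xconj ^~ p).
Proof.
move=> Pp; have H m n : (m < n)%N -> xconj m p <> xconj n p.
  move=> mn; rewrite -(subnKC (ltnW mn)) xconjD => /xconj_inj/esym.
  by apply: P_free; rewrite ?subn_gt0.
by move=> m n E; case: (ltngtP m n) => // /H; rewrite E.
Qed.


Lemma x'conj_nat_inj p : P p -> injective (x'conj ^~ p).
Proof.
move=> Pp; have H m n : (m < n)%N -> x'conj m p <> x'conj n p.
  move=> mn /(congr1 (xconj n)); rewrite x'conjK -{1}(subnK (ltnW mn)) xconjD.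
  by rewrite x'conjK; apply: P_free; rewrite ?subn_gt0.
by move=> m n E; case: (ltngtP m n) => // /H; rewrite E.
Qed.

(** * Traces along the orbits of [X] *)

Lemma orbit_vanish p v : P p -> exists N, forall k, (N <= k)%N ->
  p (iter k X v) = 0 /\ p (iter k X' v) = 0.
Proof.
(* The value of [p] at X^k v is the X^k-image of the polar part of [v] at the place k steps before
   that of [p]. These places differ for different k, and [v] has finitely many poles; likewise in
   the other direction. *)
move=> Pp; have [s Hs] := P_fin v.
have [M HM] := inj_leaves_seq s (xconj_nat_inj Pp).
have [N HN] := inj_leaves_seq s (x'conj_nat_inj Pp).
exists (maxn M N) => k; rewrite geq_max => /andP[Mk Nk]; split.
  apply: (can_inj (iterK k X'K)); rewrite (zm0 (iter_zm k X'_zm)).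
  apply: NNPP => /(Hs (x'conj k p) (P_x'conj k Pp)); exact: HN.
apply: (can_inj (iterK k XK)); rewrite (zm0 (iter_zm k X_zm)).
apply: NNPP => /(Hs (xconj k p) (P_xconj k Pp)); exact: HM.
Qed.

(** The exponents of [X] run from -n to n - 1. Each summand is the polar part of [v] at one place of
    the orbit, transported to the place of [p]. *)
Definition xsum n p v :=
  \sum_(k < n) p (iter k X v) + \sum_(k < n) p (iter k.+1 X' v).

Lemma xsumS n p v :
  xsum n.+1 p v = xsum n p v + (p (iter n X v) + p (iter n.+1 X' v)).
Proof. by rewrite /xsum !big_ord_recr /= addrACA. Qed.

Definition stab (c : nat -> V) b := exists N, forall n, (N <= n)%N -> c n = b.

Lemma stab_uniq c b1 b2 : stab c b1 -> stab c b2 -> b1 = b2.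
Proof.
case=> N1 H1 [N2 H2].
by rewrite -(H1 (maxn N1 N2)) ?leq_maxl // H2 ?leq_maxr.
Qed.

(** The sum over the whole orbit has finite support and is encoded as the eventual value of its
    partial sums. For [p] in [P] such a value exists by [orbit_vanish]. *)
Definition trace p v : V := epsilon (inhabits 0) (stab (fun n => xsum n p v)).

Lemma traceP p v : P p -> stab (fun n => xsum n p v) (trace p v).
Proof.
move=> Pp; apply: epsilon_spec; have [N HN] := orbit_vanish v Pp.
exists (xsum N p v), N => n; elim: n => [|n IH].
  by rewrite leqn0 => /eqP->.
rewrite leq_eqVlt => /orP[/eqP-> //|]; rewrite ltnS => Nn.
by rewrite xsumS IH // (HN n Nn).1 (HN n.+1 (leqW Nn)).2 !addr0.
Qed.

Lemma trace_eq p v b : P p -> stab (fun n => xsum n p v) b -> trace p v = b.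
Proof. by move=> Pp; apply: stab_uniq; apply: traceP. Qed.

Lemma xsumB n p u v : P p -> xsum n p (u - v) = xsum n p u - xsum n p v.
Proof.
move=> Pp; elim: n => [|n IH]; first by rewrite /xsum !big_ord0 addr0 subr0.
rewrite !xsumS IH (zmB (iter_zm n X_zm)) (zmB (iter_zm n.+1 X'_zm)).
by rewrite !(zmB (P_zm Pp)) addrBACA3.
Qed.

Lemma trace_zm p : P p -> zmod_morphism (trace p).
Proof.
move=> Pp u v; apply: trace_eq => //.
have [[M HM] [N HN]] := (traceP u Pp, traceP v Pp).
exists (maxn M N) => n; rewrite geq_max => /andP[Mn Nn].
by rewrite xsumB // HM // HN.
Qed.

(** The partial sums telescope to p (X^n h) - p (X^-n h), and both terms vanish for large n. *)
Lemma trace_dx p h : P p -> trace p (X h - h) = 0.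
Proof.
move=> Pp; apply: trace_eq => //; have [N HN] := orbit_vanish h Pp.
have E n : xsum n p (X h - h) = p (iter n X h) - p (iter n X' h).
  elim: n => [|n IH]; first by rewrite /xsum !big_ord0 subrr addr0.
  rewrite xsumS IH (zmB (iter_zm n X_zm)) (zmB (iter_zm n.+1 X'_zm)).
  rewrite !(zmB (P_zm Pp)) -!iterSr [iter n.+1 X' (X h)]iterSr XK.
  by rewrite addr_telescope.
by exists N => n /HN[]; rewrite E => -> ->; rewrite subrr.
Qed.

Lemma trace_x p k v : P p -> trace p (iter k X v) = trace p v.
Proof.
move=> Pp; elim: k => //= k <-; apply/eqP; rewrite -subr_eq0.
by rewrite -(zmB (trace_zm Pp)) trace_dx.
Qed.

(** The trace being invariant under [X], [v] may be replaced by X^k v; then [xconj k p] intertwines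
    the summands with those for [p], one by one. *)
Lemma trace_xconj k p v : P p -> trace (xconj k p) v = iter k X (trace p v).
Proof.
move=> Pp; rewrite -(trace_x k); last exact: P_xconj.
apply: trace_eq; first exact: P_xconj; have [N HN] := traceP v Pp.
exists N => n /HN <-; rewrite /xsum (zmD (iter_zm k X_zm)).
rewrite !(zm_sum (iter_zm k X_zm)); congr (_ + _); apply: eq_bigr => i _.
  by rewrite -iterD addnC iterD xconj_intertwine.
rewrite -xconj_intertwine; congr xconj.
move: (i.+1 : nat) => j; apply: (can_inj (iterK j XK)).
by rewrite (iterK j X'K) -iterD addnC iterD (iterK j X'K).
Qed.

Lemma trace_yconj k p v :
  P p -> trace (yconj k p) (iter k Y v) = iter k Y (trace p v).
Proof.
move=> Pp; apply: trace_eq; first exact: P_yconj.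
have [N HN] := traceP v Pp.
exists N => n /HN <-; rewrite /xsum (zmD (iter_zm k Y_zm)).
rewrite !(zm_sum (iter_zm k Y_zm)); congr (_ + _); apply: eq_bigr => i _.
  by rewrite iXYC yconj_intertwine.
by rewrite iX'YC yconj_intertwine.
Qed.

Lemma trace_xequiv p1 p2 v : P p1 -> P p2 -> xequiv p1 p2 ->
  trace p1 v = 0 -> trace p2 v = 0.
Proof.
move=> P1 P2 [k [l E]] H; apply: (can_inj (iterK l XK)).
by rewrite -trace_xconj // -E trace_xconj // H !(zm0 (iter_zm _ X_zm)).
Qed.

(** Says that [Y] fixes the class of [v] modulo the image of X - 1. For v = g and u = f this is the
    hypothesis of the theorem. *)
Definition coinv_fixed v := exists u, Y v - v = X u - u.

Lemma trace_y p k v : P p -> coinv_fixed v -> trace p (iter k Y v) = trace p v.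
Proof.
move=> Pp [u E]; elim: k => // k <-; apply/eqP; rewrite -subr_eq0.
rewrite -(zmB (trace_zm Pp)) iterSr -(zmB (iter_zm k Y_zm)) E.
have -> : iter k Y (X u - u) = X (iter k Y u) - iter k Y u.
  by rewrite (zmB (iter_zm k Y_zm)) -(iXYC 1 k u).
by rewrite trace_dx.
Qed.

Lemma trace_yconj_fixed p k v :
  P p -> coinv_fixed v -> trace (yconj k p) v = iter k Y (trace p v).
Proof. move=> Pp fv; rewrite -(trace_y k _ fv); last exact: P_yconj.
exact: trace_yconj. Qed.

Lemma orth_x p1 p2 k b : P p1 -> P p2 -> p1 <> xconj k p2 -> p2 b = b ->
  p1 (iter k X b) = 0.
Proof.
move=> P1 P2 ne <-; rewrite -xconj_intertwine; apply: P_orth => //.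
exact: P_xconj.
Qed.

Lemma orth_x' p1 p2 k b : P p1 -> P p2 -> xconj k p1 <> p2 -> p2 b = b ->
  p1 (iter k X' b) = 0.
Proof.
move=> P1 P2 ne E; apply: (can_inj (iterK k XK)); rewrite (zm0 (iter_zm _ X_zm)).
by rewrite -[LHS]/(xconj k p1 b) -E P_orth //; apply: P_xconj.
Qed.

(** Every nontrivial translate of [b] is polar at another place, because the orbit of [p] is free.
    Only the exponent 0 contributes, and it is present as soon as n >= 1. *)
Lemma trace_own p b : P p -> p b = b -> trace p b = b.
Proof.
move=> Pp E; apply: trace_eq => //; exists 1 => -[//|n _].
rewrite /xsum big_ord_recl /= E !big1 ?addr0 // => i _.
  by apply: (@orth_x' p p i.+1) => //; apply: P_free.
by apply: (@orth_x p p i.+1) => // /esym; apply: P_free.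
Qed.

Lemma trace_other p1 p2 b : P p1 -> P p2 -> ~ xequiv p1 p2 -> p2 b = b ->
  trace p1 b = 0.
Proof.
move=> P1 P2 ne E; apply: trace_eq => //; exists 0 => n _.
rewrite /xsum !big1 ?addr0 // => i _.
  by apply: (@orth_x' p1 p2 i.+1) => // H; apply: ne; exists i.+1, 0.
by apply: (@orth_x p1 p2 i) => // H; apply: ne; exists 0, i.
Qed.

Lemma trace_range p v : P p -> p (trace p v) = trace p v.
Proof.
move=> Pp; have [N HN] := traceP v Pp; rewrite -(HN N) //.
rewrite /xsum (zmD (P_zm Pp)) !(zm_sum (P_zm Pp)).
by congr (_ + _); apply: eq_bigr => i _; rewrite P_idem.
Qed.

(** A nonzero trace has a nonzero summand, so the orbit of [p] passes through a pole of [v]. *)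
Lemma trace_fin v : exists s : seq (V -> V),
  forall p, P p -> trace p v <> 0 -> exists2 a, List.In a s & xequiv p a.
Proof.
have [s Hs] := P_fin v; exists s => p Pp t0; apply: NNPP => H; apply: t0.
apply: trace_eq => //; exists 0 => n _; rewrite /xsum !big1 ?addr0 // => i _.
  apply: (can_inj (iterK i.+1 XK)); rewrite (zm0 (iter_zm _ X_zm)).
  apply: NNPP => /(Hs (xconj i.+1 p) (P_xconj _ Pp)) Hin; apply: H.
  by exists (xconj i.+1 p) => //; exists i.+1, 0.
apply: (can_inj (iterK i X'K)); rewrite (zm0 (iter_zm _ X'_zm)).
apply: NNPP => /(Hs (x'conj i p) (P_x'conj _ Pp)) Hin; apply: H.
by exists (x'conj i p) => //; exists 0, i; rewrite x'conjK.
Qed.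

(** The trace at the k-th [Y]-translate of [p] is Y^k of the trace at [p], hence nonzero for all k.
    If these translates lay in pairwise different [X]-orbits, infinitely many orbits would meet the
    finite set of poles of [v]. *)
Lemma yorbit_recurrent p v : P p -> coinv_fixed v -> trace p v <> 0 ->
  exists2 t, (0 < t)%N & xequiv (yconj t p) p.
Proof.
move=> Pp fv t0; have [s Hs] := trace_fin v; apply: NNPP => H.
have K i j a : (i < j)%N -> xequiv (yconj i p) a -> ~ xequiv (yconj j p) a.
  move=> ij Ei /xequiv_trans/(_ (xequiv_sym Ei)).
  rewrite -(subnKC (ltnW ij)) yconjD => /xequiv_yconj E.
  by apply: H; exists (j - i)%N => //; rewrite subn_gt0.
have [i j a Ei Ej|N HN] :=
  @eventually_unrelated _ (fun k a => xequiv (yconj k p) a) s.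
  by case: (ltngtP i j) => // /K H'; [case: (H' a)|case: (H' a)].
have [|a /(HN N (leqnn N))//] := Hs _ (P_yconj N Pp).
rewrite trace_yconj_fixed // => E; apply: t0.
by apply: (can_inj (iterK N YK)); rewrite E (zm0 (iter_zm N Y_zm)).
Qed.

Lemma iter_dx k v : exists u, iter k X v - v = X u - u.
Proof.
elim: k => [|k [u E]]; first by exists 0; rewrite (zm0 X_zm) !subrr.
exists (iter k X v + u); rewrite (zmD X_zm) opprD addrACA -E /=.
by rewrite subrKA.
Qed.

(** Applying Y - 1 to the sum gives Y^t b - b. Modulo the image of X - 1 this is X^k Y^t b - X^l b,
    which is 0. *)
Lemma orbit_fixed b t k l : iter k X (iter t Y b) = iter l X b ->
  coinv_fixed (\sum_(j < t) iter j Y b).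
Proof.
move=> E; have [[u Hu] [w Hw]] := (iter_dx l b, iter_dx k (iter t Y b)).
exists (u - w); have -> : X (u - w) - (u - w) = (X u - u) - (X w - w).
  by rewrite (zmB X_zm) addrBBC.
rewrite -Hu -Hw E opprB [RHS]addrC subrKA.
elim: t {E w Hw} => [|t IH]; first by rewrite big_ord0 (zm0 Y_zm) !subrr.
by rewrite big_ord_recr /= (zmD Y_zm) opprD addrACA IH addrC subrKA.
Qed.

(** * Removal of traces and polar parts, with [S] standing for the representable g *)

Variable S : V -> Prop.
Hypothesis S_D : forall u v, S u -> S v -> S (u + v).
Hypothesis S_dx : forall h, S (X h - h).
Hypothesis S_orb : forall b t k l, (0 < t)%N ->
  iter k X (iter t Y b) = iter l X b -> S (\sum_(j < t) iter j Y b).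

(** The conclusion also covers places where the trace of [v] is already 0: no new nonzero trace may
    appear, or the induction on the orbits would not end. *)
Lemma kill_trace p v : P p -> coinv_fixed v -> trace p v <> 0 ->
  exists g, [/\ S g, coinv_fixed g & forall p1, P p1 ->
    xequiv p1 p \/ trace p1 v = 0 -> trace p1 (v - g) = 0].
Proof.
move=> Pp fv t0; have [t1 t1_gt0 H1] := yorbit_recurrent Pp fv t0.
(* The orbit sum must stop just before the [Y]-translates of [p] return to its [X]-orbit for the
   first time, so that no orbit is counted twice. *)
have [t [t_gt0 [k [l E]] t_min]] 
  := @ex_min_pos (fun t => xequiv (yconj t p) p) t1 t1_gt0 H1.
set b := trace p v.
have Eb : iter k X (iter t Y b) = iter l X b.
  rewrite -trace_yconj_fixed // -!trace_xconj //; first by rewrite E.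
  exact: P_yconj.
have own j : yconj j p (iter j Y b) = iter j Y b.
  by rewrite yconj_intertwine trace_range.
(* By minimality of [t], the first [t] translates of [p] lie in pairwise different [X]-orbits, so
   each of these orbits sees exactly one summand. *)
have ne i j : (i < t)%N -> (j < t)%N -> i <> j ->
    ~ xequiv (yconj i p) (yconj j p).
  wlog ij : i j / (i < j)%N.
    move=> W it jt nij; case: (ltngtP i j) => // H; first exact: W.
    by move=> /xequiv_sym; apply: W => // /esym.
  move=> _ jt _; rewrite -(subnKC (ltnW ij)) yconjD => /xequiv_yconj/xequiv_sym.
  by apply: t_min; rewrite subn_gt0 ij (leq_ltn_trans (leq_subr _ _) jt).
exists (\sum_(j < t) iter j Y b); split.
- exact: S_orb Eb.
- exact: orbit_fixed Eb.
move=> p1 P1 H; rewrite (zmB (trace_zm P1)) (zm_sum (trace_zm P1)).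
(* Either [p1] is in the orbit of the i-th translate, where the i-th summand cancels the trace Y^i b
   of [v], or every summand has trace 0 at [p1]. In the latter case [p1] is not in the orbit of [p],
   which is the case i = 0, so [H] gives trace 0 for [v]. *)
case: (classic (exists2 i, (i < t)%N & xequiv (yconj i p) p1)) => [[i it Ei]|N].
  rewrite -(zm_sum (trace_zm P1)) -(zmB (trace_zm P1)).
  have Pi := P_yconj i Pp; apply: (trace_xequiv Pi P1 Ei).
  rewrite (zmB (trace_zm Pi)) (zm_sum (trace_zm Pi)) (bigD1 (Ordinal it)) //=.
  rewrite (trace_own Pi (own i)) (trace_yconj_fixed i Pp fv).
  rewrite big1 ?addr0 ?subrr // => j ji.
  apply: trace_other (own j) => //; first exact: P_yconj.
  by apply: ne => // /esym ij; case/eqP: ji; apply: val_inj.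
rewrite big1 ?subr0 => [|j _]; last first.
  apply: trace_other (own j) => //; first exact: P_yconj.
  by move=> /xequiv_sym Ej; apply: N; exists j.
by case: H => // Ep; case: N; exists 0 => //; apply: xequiv_sym.
Qed.

Lemma coinv_fixedB v w :
  coinv_fixed v -> coinv_fixed w -> coinv_fixed (v - w).
Proof.
move=> [a Ea] [b Eb]; exists (a - b).
by rewrite (zmB X_zm) (zmB Y_zm) addrBBC Ea Eb addrBBC.
Qed.

Lemma coinv_fixed_dx h : coinv_fixed (X h - h).
Proof.
by exists (Y h - h); rewrite (zmB X_zm) (zmB Y_zm) XYC addrBBC.
Qed.

(** Induction on a list of orbits that contains all those with nonzero trace: [kill_trace] clears
    the head and leaves the tail a valid list. *)
Lemma kill_traces v : coinv_fixed v ->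
  exists g, S g /\ forall p, P p -> trace p (v - g) = 0.
Proof.
have [s] := trace_fin v; elim: s v => [|a s IH] v Hs fv.
  exists 0; split=> [|p Pp]; first by have := S_dx 0; rewrite (zm0 X_zm) subrr.
  by rewrite subr0; apply: NNPP => /(Hs p Pp)[].
case: (classic (exists p, [/\ P p, xequiv p a & trace p v <> 0])); last first.
  move=> N; apply: IH => // p Pp t0; have [a' [<- E|]] := Hs p Pp t0.
    by case: N; exists p.
  by exists a'.
case=> p [Pp Ea t0]; have [g [Sg [u Eu] Hg]] := kill_trace Pp fv t0.
have [||g' [Sg' Hg']] := IH (v - g).
- move=> p1 P1 t1; have [|a' [aa E|]] := Hs p1 P1.
  + by move=> t1'; apply: t1; apply: Hg => //; right.
  + case: t1; apply: Hg => //; left; apply: xequiv_trans (xequiv_sym Ea).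
    by rewrite aa.
  by exists a'.
- by apply: coinv_fixedB => //; exists u.
exists (g + g'); split; first exact: S_D.
by move=> p1 P1; rewrite opprD addrA; apply: Hg'.
Qed.

(** At the cost of an element of the image of X - 1, the polar part at one pole can be pushed along
    its orbit onto another pole of [v]. Each push shortens the list of poles, and vanishing of the
    trace excludes that a single pole remains in an orbit. *)
Lemma clear_poles v : (forall p, P p -> trace p v = 0) ->
  exists h, forall p, P p -> p (v - (X h - h)) = 0.
Proof.
have [s] := P_fin v; elim: s v => [|a s IH] v Hs tv.
  exists 0 => p Pp; rewrite (zm0 X_zm) !subr0.
  by apply: NNPP => /(Hs p Pp).
case: (classic (P a /\ a v <> 0)) => [[Pa av]|N]; last first.
  apply: IH => // p Pp pv; case: (Hs p Pp pv) => // E.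
  by case: N; rewrite E.
(* The target [p1] is already a pole of [v] other than [a], so it belongs to the tail [s]; after the
   push all poles lie in [s]. *)
suff [h [p1 [P1 p1v p1a Hh]]] : exists h p1, [/\ P p1, p1 v <> 0, p1 <> a
    & forall p, P p -> p <> p1 -> p (v - (X h - h)) = p v - p (a v)].
  have [||h' Hh'] := IH (v - (X h - h)); last first.
  - exists (h + h') => p Pp; have -> : X (h + h') - (h + h')
        = X h - h + (X h' - h') by rewrite (zmD X_zm) opprD addrACA.
    by rewrite opprD addrA; apply: Hh'.
  - by move=> p Pp; rewrite (zmB (trace_zm Pp)) trace_dx // tv // subr0.
  move=> p Pp; case: (classic (p = p1)) => [-> _|pp1].
    by case: (Hs p1 P1 p1v) => // /esym.
  rewrite Hh //; case: (classic (p = a)) => [->|pa].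
    by rewrite P_idem // subrr.
  by rewrite (P_orth Pp Pa pa) subr0 => /(Hs p Pp)[/esym|].
(* The trace at [a] is 0 but its summand [a v] of exponent 0 is not, so another summand is
   nonzero. *)
have [k Hk] : exists k, a (iter k.+1 X v) <> 0 \/ a (iter k.+1 X' v) <> 0.
  apply: NNPP => N; case: av; rewrite -(tv a Pa); apply/esym/trace_eq => //.
  exists 1 => -[//|n _]; rewrite /xsum big_ord_recl /= !big1 ?addr0 // => i _.
    by apply: NNPP => H; apply: N; exists i; right.
  by apply: NNPP => H; apply: N; exists i; left.
have aav := P_idem Pa v.
(* The second pole lies before or after [a] in the orbit. The push goes backward in the first case
   and forward in the second, whence the opposite signs of the witnesses. *)
case: Hk => Hk.
  have [u Hu] := iter_dx k.+1 (iter k.+1 X' (a v)).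
  exists u, (x'conj k.+1 a); split.
  - exact: P_x'conj.
  - move=> H; apply: Hk; apply: (can_inj (iterK k.+1 X'K)).
    by rewrite (zm0 (iter_zm _ X'_zm)).
  - by move/(congr1 (xconj k.+1)); rewrite x'conjK => /esym; apply: P_free.
  move=> p Pp pp1; rewrite -Hu (iterK k.+1 X'K) opprB addrCA (zmD (P_zm Pp)).
  rewrite (zmB (P_zm Pp)) (@orth_x' p a) ?add0r // => E; apply: pp1.
  by apply: (@xconj_inj k.+1); rewrite x'conjK.
have [u Hu] := iter_dx k.+1 (a v).
exists (- u), (xconj k.+1 a); split.
- exact: P_xconj.
- move=> H; apply: Hk; apply: (can_inj (iterK k.+1 XK)).
  by rewrite (zm0 (iter_zm _ X_zm)).
- exact: P_free.
move=> p Pp pp1; rewrite (zmN X_zm) -opprD -Hu opprK addrCA (zmD (P_zm Pp)).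
by rewrite (zmB (P_zm Pp)) (@orth_x p a) ?add0r.
Qed.

Theorem coinv_fixed_decomposition v : coinv_fixed v ->
  exists2 g, S g & forall p, P p -> p (v - g) = 0.
Proof.
move=> fv; have [g [Sg Hg]] := kill_traces fv; have [h Hh] := clear_poles Hg.
by exists (g + (X h - h)); [apply: S_D | move=> p Pp; rewrite opprD addrA Hh].
Qed.
End Coinvariants.

(** * Polar parts *)

Lemma subf_div (F : fieldType) (a b c d : F) : b != 0 -> d != 0 ->
  a / b - c / d = (a * d - c * b) / (b * d).
Proof. by move=> b0 d0; rewrite -mulNr addf_div // mulNr. Qed.

(** * Irreducible factors of univariate polynomials *)

Section Irreducible.
Variable L : fieldType.
Implicit Types (a b d e m p : {poly L}).

Lemma irredp_coprimep d b :
  irreducible_poly d -> ~~ (d %| b) -> coprimep d b.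
Proof.
move=> irr ndb; rewrite coprimep_def; apply: contraNT ndb => g1.
have /andP[_ dg] := irr _ g1 (dvdp_gcdl d b).
exact: dvdp_trans dg (dvdp_gcdr d b).
Qed.

Lemma irredp_dvd_mul d a b :
  irreducible_poly d -> (d %| a * b) = (d %| a) || (d %| b).
Proof.
move=> irr; have [da|nda] := boolP (d %| a); first by rewrite dvdp_mulr.
by rewrite Gauss_dvdpr ?irredp_coprimep.
Qed.

Lemma irredp_dvd_exp d a k : irreducible_poly d -> d %| a ^+ k -> d %| a.
Proof.
move=> irr; elim: k => [|k IH]; last first.
  by rewrite exprS irredp_dvd_mul // => /orP[].
by move/dvdp_leq; rewrite oner_eq0 size_poly1 leqNgt irr.1 => /(_ isT).
Qed.

Lemma irredp_dvd_eqp d e :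
  irreducible_poly d -> irreducible_poly e -> d %| e -> d %= e.
Proof. by move=> [sd _] [_ irr] /irr; apply; case: ltngtP sd. Qed.

Lemma ltn_size_mul_irredp m d : irreducible_poly d -> m != 0 ->
  (size m < size (m * d)%R)%N.
Proof.
move=> irr m0; rewrite size_mul ?(irredp_neq0 irr) //.
by case: (size d) irr.1 => [|[|k]] // _; rewrite !addnS /= ltnS leq_addr.
Qed.

Lemma irredp_exists b : size b != 1 ->
  exists2 d, irreducible_poly d & d %| b.
Proof.
case: (eqVneq b 0) => [-> _|b0].
  (* The assumption on the size admits b = 0, which every irreducible polynomial divides. *)
  by exists 'X; [rewrite -['X]subr0; apply: irredp_XsubC | apply: dvdp0].
elim/ltn_ind: (size b) {-2}b b0 (erefl (size b)) => n IH {}b b0 sb n1.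
case: (classic (irreducible_poly b)) => [irr|N]; first by exists b.
have n_gt1 : (1 < size b)%N by rewrite ltn_neqAle eq_sym n1 lt0n size_poly_eq0.
have [e [e1 eb neb]] : exists e, [/\ size e != 1, e %| b & ~~ (e %= b)].
  apply: NNPP => H; apply: N; split=> // e e1 eb; apply/negPn/negP => neb.
  by apply: H; exists e.
have e0 : e != 0 by apply: contraTneq eb => ->; rewrite dvd0p.
have [|d irr de] := IH (size e) _ e e0 erefl e1.
  by rewrite sb ltn_neqAle dvdp_leq // andbT dvdp_size_eqp.
by exists d => //; apply: dvdp_trans eb.
Qed.

Lemma irredp_divisors_fin b : b != 0 -> exists s : seq {poly L},
  forall d, irreducible_poly d -> d %| b ->
    exists2 e, List.In e s & irreducible_poly e /\ d %= e.
Proof.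
elim/ltn_ind: (size b) {-2}b (erefl (size b)) => n IH {}b sb b0.
have [s1|s1] := eqVneq (size b) 1.
  exists [::] => d irr /dvdp_leq-/(_ b0).
  by rewrite s1 leqNgt irr.1.
have [d irr /dvdpP[m bE]] := irredp_exists s1.
have m0 : m != 0 by apply: contraNneq b0 => m0; rewrite bE m0 mul0r.
have [|s Hs] := IH (size m) _ m erefl m0.
  by rewrite -sb bE ltn_size_mul_irredp.
exists (d :: s) => e irre; rewrite bE irredp_dvd_mul // => /orP[/(Hs e irre)[a]|].
  by exists a => //; right.
by exists d; [left | split=> //; apply: irredp_dvd_eqp].
Qed.

Lemma dvdp_max_power d b : irreducible_poly d -> b != 0 ->
  exists k m, b = m * d ^+ k /\ ~~ (d %| m).
Proof.
move=> irr; elim/ltn_ind: (size b) {-2}b (erefl (size b)) => n IH {}b sb b0.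
have [/dvdpP[m bE]|N] := boolP (d %| b); last first.
  by exists 0, b; rewrite expr0 mulr1.
have m0 : m != 0 by apply: contraNneq b0 => m0; rewrite bE m0 mul0r.
have [|k [m' [mE N]]] := IH (size m) _ m erefl m0.
  by rewrite -sb bE ltn_size_mul_irredp.
by exists k.+1, m'; rewrite exprSr mulrA -mE.
Qed.

Lemma size_mul_exp_lt d a k (m : nat) : d != 0 ->
  (size a < size (d ^+ k))%N ->
  (size (a * d ^+ m)%R < size (d ^+ (k + m)))%N.
Proof.
move=> d0; have [->|a0] := eqVneq a 0.
  by rewrite mul0r size_poly0 !size_poly_gt0 !expf_neq0.
have s_gt0 : (0 < size (d ^+ m))%N by rewrite size_poly_gt0 expf_neq0.
rewrite exprD !size_mul ?expf_neq0 // -[size (d ^+ m)]prednK // !addnS /=.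
by rewrite ltn_add2r.
Qed.
End Irreducible.

(** * The polar part of a fraction at an irreducible polynomial *)

Section PolarParts.
Variables (L F : fieldType) (iota : {rmorphism {poly L} -> F}).
Hypothesis iota_inj : injective iota.
Hypothesis iota_frac : forall f, exists a b, b != 0 /\ f = iota a / iota b.
Implicit Types (a b d e m p : {poly L}) (f r : F) (k : nat).

Lemma iota_eq0 p : (iota p == 0) = (p == 0).
Proof. by rewrite -(inj_eq iota_inj) rmorph0. Qed.

(** Taking the fraction proper normalizes it: for irreducible [d] it is then determined modulo the
    fractions regular at [d]. *)
Definition polar d r :=
  exists k a, (size a < size (d ^+ k))%N /\ r = iota a / iota (d ^+ k).
Definition regular d r := exists a b, ~~ (d %| b) /\ r = iota a / iota b.

Section Place.
Variable d : {poly L}.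
Hypothesis irr : irreducible_poly d.
Let d0 : d != 0. Proof. exact: irredp_neq0. Qed.
Let ndvd0 b : ~~ (d %| b) -> b != 0.
Proof. by apply: contraNneq => ->; apply: dvdp0. Qed.

Lemma polarB r s : polar d r -> polar d s -> polar d (r - s).
Proof.
move=> [k [a [sa ->]]] [l [b [sb ->]]].
exists (k + l)%N, (a * d ^+ l - b * d ^+ k); split.
  apply: leq_ltn_trans (size_polyD _ _) _; rewrite size_polyN gtn_max.
  by rewrite size_mul_exp_lt //= addnC size_mul_exp_lt.
by rewrite subf_div ?iota_eq0 ?expf_neq0 // exprD rmorphB !rmorphM.
Qed.

Lemma regularB r s : regular d r -> regular d s -> regular d (r - s).
Proof.
move=> [a [b [db ->]]] [a' [b' [db' ->]]].
exists (a * b' - a' * b), (b * b'); split.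
  by rewrite irredp_dvd_mul // negb_or db.
have [b0 b'0] := (ndvd0 db, ndvd0 db').
by rewrite subf_div ?iota_eq0 // rmorphB !rmorphM.
Qed.

Lemma polar0 : polar d 0.
Proof. by exists 0%N, 0; rewrite size_poly0 expr0 size_poly1 rmorph0 mul0r. Qed.
Lemma regular0 : regular d 0.
Proof.
exists 0, 1; rewrite rmorph0 mul0r; split=> //.
by apply: contraL irr.1 => /dvdp_leq; rewrite oner_eq0 size_poly1 -leqNgt; apply.
Qed.

(** Since [d] does not divide the denominator of a regular fraction, d^k must divide the numerator
    [a], whose size is too small unless a = 0. *)
Lemma polar_regular0 r : polar d r -> regular d r -> r = 0.
Proof.
move=> [k [a [sa ->]]] [b [m [dm /eqP]]].
have m0 := ndvd0 dm.
rewrite eqr_div ?iota_eq0 ?expf_neq0 // -!rmorphM (inj_eq iota_inj).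
move=> /eqP E; suff -> : a = 0 by rewrite rmorph0 mul0r.
have : d ^+ k %| a * m by rewrite E dvdp_mulIr.
rewrite Gauss_dvdpl; last by apply: coprimep_expl; apply: irredp_coprimep.
by move=> /dvdp_leq H; apply/eqP/negPn/negP => /H; rewrite leqNgt sa.
Qed.

(** Partial fractions: from u d^k + v m = 1 follows a / (m d^k) = a u / m + a v / d^k. Reducing a v
    modulo d^k makes the second term proper and moves the quotient to the regular term. *)
Lemma polar_split f : exists2 r, polar d r & regular d (f - r).
Proof.
have [a [b [b0 ->]]] := iota_frac f.
have [k [m [bE dm]]] := dvdp_max_power irr b0.
have co : coprimep (d ^+ k) m by apply: coprimep_expl; apply: irredp_coprimep.
have [[u v] /= E] := Bezout_eq1_coprimepP _ _ co.
have dk0 : d ^+ k != 0 by rewrite expf_neq0.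
exists (iota ((a * v) %% d ^+ k) / iota (d ^+ k)).
  by exists k, ((a * v) %% d ^+ k); rewrite ltn_modpN0.
exists (a * u + (a * v) %/ d ^+ k * m), m; split=> //.
have m0 := ndvd0 dm.
apply/eqP; rewrite subf_div ?iota_eq0 // -!rmorphM -rmorphB.
rewrite eqr_div ?iota_eq0 ?mulf_neq0 // -!rmorphM (inj_eq iota_inj) bE.
have -> : (a * v) %% d ^+ k = a * v - (a * v) %/ d ^+ k * d ^+ k.
  by rewrite {2}(divp_eq (a * v) (d ^+ k)) addrC addKr.
have -> : a * d ^+ k = a * (u * d ^+ k + v * m) * d ^+ k by rewrite E mulr1.
apply/eqP; ring.
Qed.
End Place.

Definition pole d f : F :=
  epsilon (inhabits 0) (fun r => polar d r /\ regular d (f - r)).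

Lemma poleP d f : irreducible_poly d ->
  polar d (pole d f) /\ regular d (f - pole d f).
Proof.
move=> irr; have [r ? ?] := polar_split irr f.
apply: (@epsilon_spec F (inhabits 0) (fun r => polar d r /\ regular d (f - r))).
by exists r.
Qed.

Lemma pole_eq d f r : irreducible_poly d ->
  polar d r -> regular d (f - r) -> pole d f = r.
Proof.
move=> irr rP rR; have [pP pR] := poleP f irr.
apply/eqP; rewrite -subr_eq0; apply/eqP; apply: (polar_regular0 irr).
  exact: polarB.
have -> : pole d f - r = (f - r) - (f - pole d f).
  by rewrite addrBBC subrr sub0r opprB.
exact: regularB.
Qed.

Lemma pole0_regular d f : irreducible_poly d -> pole d f = 0 <-> regular d f.
Proof.
move=> irr; split=> [E|R]; first by have [_] := poleP f irr; rewrite E subr0.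
by apply: pole_eq; rewrite ?subr0 //; apply: polar0.
Qed.

Lemma pole_zm d : irreducible_poly d -> zmod_morphism (pole d).
Proof.
move=> irr f g; have [[? ?] [? ?]] := (poleP f irr, poleP g irr).
apply: pole_eq => //; first exact: polarB.
by rewrite addrBBC; apply: regularB.
Qed.

Lemma pole_idem d f : irreducible_poly d -> pole d (pole d f) = pole d f.
Proof.
move=> irr; apply: pole_eq => //; first exact: (poleP f irr).1.
by rewrite subrr; apply: regular0.
Qed.

Lemma polar_eqp d e r : irreducible_poly d -> d %= e -> polar d r -> polar e r.
Proof.
move=> irr de [k [a [sa ->]]].
have dk0 : d ^+ k != 0 by rewrite expf_neq0 ?irredp_neq0.
have ek0 : e ^+ k != 0
  by rewrite -size_poly_eq0 -(eqp_size (eqp_exp k de)) size_poly_eq0.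
have /eqpf_eq[c c0 E] := eqp_exp k de.
exists k, (c^-1 *: a); rewrite size_scale ?invr_eq0 //; split.
  by rewrite -(eqp_size (eqp_exp k de)).
apply/eqP; rewrite eqr_div ?iota_eq0 // -!rmorphM (inj_eq iota_inj) E.
by rewrite -scalerAl -scalerAr scalerA mulVf ?scale1r.
Qed.

Lemma regular_eqp d e r : d %= e -> regular d r -> regular e r.
Proof.
by move=> de [a [b [db ->]]]; exists a, b; rewrite -(eqp_dvdl b de).
Qed.

(** A place is an irreducible polynomial up to association, while the abstract argument compares
    projections by equality. This lemma and [pole_inj_eqp] translate between the two. *)
Lemma pole_eqp d e : irreducible_poly d -> irreducible_poly e -> d %= e ->
  pole d = pole e.
Proof.
move=> irr irre de; apply: functional_extensionality => f.
have [pP pR] := poleP f irr; apply/esym/pole_eq => //.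
  exact: polar_eqp pP.
exact: regular_eqp pR.
Qed.

Lemma polar_regular d e r : irreducible_poly d -> irreducible_poly e ->
  ~~ (d %= e) -> polar e r -> regular d r.
Proof.
move=> irr irre N [k [a [sa ->]]]; exists a, (e ^+ k); split=> //.
by apply: contra N => /irredp_dvd_exp/(irredp_dvd_eqp irr irre); apply.
Qed.

Lemma pole_orth d e f : irreducible_poly d -> irreducible_poly e ->
  pole d <> pole e -> pole d (pole e f) = 0.
Proof.
move=> irr irre N; apply/pole0_regular => //.
apply: (@polar_regular d e) => //; last exact: (poleP f irre).1.
by apply/negP => /(pole_eqp irr irre); apply: N.
Qed.

(** The fraction 1 / e separates places: it is its own polar part at [e] and is regular at every [d]
    not associate to [e]. *)
Lemma pole_inj_eqp d e : irreducible_poly d -> irreducible_poly e ->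
  pole d = pole e -> d %= e.
Proof.
move=> irr irre E; apply/negPn/negP => N.
have P : polar e (iota 1 / iota e).
  by exists 1%N, 1; rewrite expr1 size_poly1; split=> //; apply: irre.1.
have : pole e (iota 1 / iota e) = 0.
  by rewrite -E; apply/pole0_regular => //; apply: polar_regular P.
rewrite (pole_eq irre P) ?subrr; last exact: regular0.
by apply/eqP; rewrite rmorph1 mul1r invr_eq0 iota_eq0 irredp_neq0.
Qed.

Lemma pole_fin f : exists s : seq (F -> F),
  forall d, irreducible_poly d -> pole d f <> 0 -> List.In (pole d) s.
Proof.
have [a [b [b0 fE]]] := iota_frac f; have [s Hs] := irredp_divisors_fin b0.
exists (map pole s) => d irr pdf.
have [|e es [irre de]] := Hs d irr.
  apply: NNPP => db; apply: pdf; apply/pole0_regular => //.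
  by exists a, b; split=> //; apply/negP.
by rewrite (pole_eqp irr irre de); apply: List.in_map.
Qed.

(** In lowest terms, every irreducible factor of the denominator is a genuine pole. *)
Lemma regular_denominator f : exists a m, [/\ m != 0, f = iota a / iota m
  & forall d, irreducible_poly d -> d %| m -> ~ regular d f].
Proof.
have [a [b [b0 fE]]] := iota_frac f.
have g0 : gcdp a b != 0 by rewrite gcdp_eq0 negb_and b0 orbT.
have aE := divpK (dvdp_gcdl a b); have bE := divpK (dvdp_gcdr a b).
have co : coprimep (a %/ gcdp a b) (b %/ gcdp a b).
  by rewrite coprimep_div_gcd // b0 orbT.
set a1 := a %/ _ in aE co; set b1 := b %/ _ in bE co.
have b10 : b1 != 0 by apply: contraNneq b0 => b10; rewrite -bE b10 mul0r.
have fE1 : f = iota a1 / iota b1.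
  rewrite fE; apply/eqP; rewrite eqr_div ?iota_eq0 // -!rmorphM.
  by rewrite (inj_eq iota_inj) -[X in _ == a1 * X]bE mulrCA [b1 * _]mulrC aE.
exists a1, b1; split=> // d irr db [a2 [m [dm /eqP]]].
have m0 : m != 0 by apply: contraNneq dm => ->; apply: dvdp0.
rewrite fE1 eqr_div ?iota_eq0 // -!rmorphM (inj_eq iota_inj) => /eqP E.
have : d %| a1 * m by rewrite E dvdp_mull.
rewrite irredp_dvd_mul // (negPf dm) orbF => da.
have : d %| gcdp a1 b1 by rewrite dvdp_gcd da.
move/dvdp_leq; rewrite gcdp_eq0 (negPf b10) andbF => /(_ isT).
by move: co; rewrite coprimep_def => /eqP->; rewrite leqNgt irr.1.
Qed.

(** * Transport of polar parts by automorphisms *)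

Section Conjugation.
Variables (T : {rmorphism F -> F}) (t : {rmorphism {poly L} -> {poly L}}).
Variable t' : {poly L} -> {poly L}.
Hypotheses (iota_t : forall p, iota (t p) = T (iota p)).
Hypotheses (t_size : forall p, size (t p) = size p) (t'K : cancel t' t).

(** The map [t] may act on the coefficients, as it will for theta_y, so it is not assumed linear
    over [L]. Injectivity comes from preservation of the size, surjectivity from [t']. *)
Lemma dvdp_aut a b : (t a %| t b) = (a %| b).
Proof.
have t0 p : t p = 0 -> p = 0.
  by move/eqP; rewrite -size_poly_eq0 t_size size_poly_eq0 => /eqP.
apply/dvdpP/dvdpP => [[c]|[c ->]]; last by exists (t c); rewrite rmorphM.
rewrite -(t'K c) -rmorphM => /eqP; rewrite -subr_eq0 -rmorphB => /eqP/t0/eqP.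
by rewrite subr_eq0 => /eqP->; exists (t' c).
Qed.

Lemma eqp_aut a b : (t a %= t b) = (a %= b).
Proof. by rewrite /eqp !dvdp_aut. Qed.

Lemma irredp_aut d : irreducible_poly d -> irreducible_poly (t d).
Proof.
move=> [sd irr]; split=> [|e]; first by rewrite t_size.
by rewrite -(t'K e) t_size dvdp_aut eqp_aut; apply: irr.
Qed.

(** Polar and regular fractions are defined by size and divisibility, which [t] preserves;
    uniqueness of the polar part does the rest. *)
Lemma pole_aut d f :
  irreducible_poly d -> pole (t d) (T f) = T (pole d f).
Proof.
move=> irr; have [[k [a [sa E]]] [b [m [dm E']]]] := poleP f irr.
apply: pole_eq; first exact: irredp_aut.
  exists k, (t a); rewrite -rmorphXn !t_size; split=> //.
  by rewrite E fmorph_div !iota_t.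
exists (t b), (t m); rewrite dvdp_aut; split=> //.
by rewrite -rmorphB E' fmorph_div !iota_t.
Qed.
End Conjugation.
End PolarParts.

(** * Places permuted by two automorphisms *)

Section Places.
Variables (L F : fieldType) (iota : {rmorphism {poly L} -> F}).
Hypothesis iota_inj : injective iota.
Hypothesis iota_frac : forall f, exists a b, b != 0 /\ f = iota a / iota b.
Variables (X Y : {rmorphism F -> F}) (X' Y' : F -> F).
Variables (x x' y y' : {rmorphism {poly L} -> {poly L}}).
Hypotheses (XK : cancel X X') (X'K : cancel X' X).
Hypotheses (YK : cancel Y Y') (Y'K : cancel Y' Y).
Hypothesis XYC : forall f, X (Y f) = Y (X f).
Hypotheses (xK : cancel x x') (x'K : cancel x' x) (y'K : cancel y' y).
Hypotheses (iota_x : forall p, iota (x p) = X (iota p)).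
Hypotheses (iota_y : forall p, iota (y p) = Y (iota p)).
Hypotheses (x_size : forall p, size (x p) = size p).
Hypotheses (y_size : forall p, size (y p) = size p).
Implicit Types (d p : {poly L}) (f g : F).

Definition aperiodic d :=
  irreducible_poly d /\ forall k, (0 < k)%N -> ~~ (iter k x d %= d).

Let xyC p : x (y p) = y (x p).
Proof. by apply: iota_inj; rewrite !(iota_x, iota_y) XYC. Qed.

Let x'_size p : size (x' p) = size p.
Proof. by rewrite -{2}(x'K p) x_size. Qed.

Lemma aperiodic_x d : aperiodic d -> aperiodic (x d).
Proof.
move=> [irr fd]; split=> [|k k0]; first exact: irredp_aut x_size x'K _ irr.
by rewrite -iterSr /= (eqp_aut x_size x'K) fd.
Qed.
Lemma aperiodic_x' d : aperiodic d -> aperiodic (x' d).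
Proof.
move=> [irr fd]; split=> [|k k0]; first exact: irredp_aut x'_size xK _ irr.
rewrite -(eqp_aut x_size x'K) x'K -iterS iterSr x'K; exact: fd.
Qed.
Lemma aperiodic_y d : aperiodic d -> aperiodic (y d).
Proof.
move=> [irr fd]; split=> [|k k0]; first exact: irredp_aut y_size y'K _ irr.
have -> : iter k x (y d) = y (iter k x d) by elim: k {k0} => //= k ->.
by rewrite (eqp_aut y_size y'K) fd.
Qed.

Lemma pole_conj (T : {rmorphism F -> F}) (T' : F -> F)
    (t t' : {rmorphism {poly L} -> {poly L}}) d :
  cancel T' T -> cancel t' t -> (forall p, size (t p) = size p) ->
  (forall p, iota (t p) = T (iota p)) -> irreducible_poly d ->
  T \o pole iota d \o T' = pole iota (t d).
Proof.
move=> T'K t'K st it irr; apply: functional_extensionality => f /=.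
by rewrite -(pole_aut iota_inj iota_frac it st t'K) ?T'K.
Qed.

Variable S : F -> Prop.
Hypothesis S_D : forall u v, S u -> S v -> S (u + v).
Hypothesis S_dx : forall h, S (X h - h).
Hypothesis S_orb : forall b t k l, (0 < t)%N ->
  iter k X (iter t Y b) = iter l X b -> S (\sum_(j < t) iter j Y b).

(** The polar parts at aperiodic places satisfy what is required of [P]: different places are
    orthogonal, aperiodicity makes orbits free, and a fraction has finitely many poles. *)
Theorem regular_decomposition v : coinv_fixed X Y v ->
  exists2 g, S g & forall d, aperiodic d -> regular iota d (v - g).
Proof.
pose P (p : F -> F) := exists2 d, aperiodic d & p = pole iota d.
have Pirr d : aperiodic d -> irreducible_poly d by case.
move=> fv.
have [||||||||g Sg Hg] := @coinv_fixed_decomposition F X X' Y Y'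
  (rmorphB X) (rmorphB Y) XK X'K YK Y'K XYC P _ _ _ _ _ _ _ _ S S_D S_dx S_orb v fv.
- by move=> p [d /Pirr irr ->]; apply: pole_zm.
- by move=> p [d /Pirr irr ->] f; apply: pole_idem.
- by move=> p1 p2 [d /Pirr irr ->] [e /Pirr irre ->] ne f; apply: pole_orth.
- move=> p [d ad ->]; exists (x d); first exact: aperiodic_x.
  by apply: pole_conj => //; apply: Pirr.
- move=> p [d ad ->]; exists (x' d); first exact: aperiodic_x'.
  (* As [X'] is given only as a function, the two sides are compared after applying the morphism
     [X]. *)
  apply: functional_extensionality => f /=; apply: (can_inj XK).
  have irr' : irreducible_poly (x' d) by apply/Pirr/aperiodic_x'.
  by rewrite X'K -(pole_aut iota_inj iota_frac iota_x x_size x'K) // x'K.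
- move=> p [d ad ->]; exists (y d); first exact: aperiodic_y.
  by apply: pole_conj => //; apply: Pirr.
- move=> p k [d ad ->] k0; have E : xconj X X' k (pole iota d)
      = pole iota (iter k x d) /\ aperiodic (iter k x d).
    elim: k {k0} => [|k [IH IH']]; first by [].
    split; last exact: aperiodic_x.
    rewrite /= -(@pole_conj X X' x x' _ X'K x'K x_size iota_x (Pirr _ IH')) -IH.
    by apply: functional_extensionality => f; rewrite /xconj /= -iterSr.
  rewrite E.1 => /(pole_inj_eqp iota_inj iota_frac (Pirr _ E.2) (Pirr _ ad)).
  by apply/negP; case: ad => _; apply.
- move=> f; have [s Hs] := pole_fin iota_inj iota_frac f; exists s.
  by move=> p [d /Pirr irr ->]; apply: Hs.
exists g => // d ad; apply/(pole0_regular iota_inj iota_frac _ (Pirr d ad)).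
by apply: Hg; exists d.
Qed.

Hypothesis S_fixed : forall g, S g -> coinv_fixed X Y g.

(** A fixed [u] is an orbit sum of length 1, with both exponents of [X] equal to 0. *)
Let S_fix u : Y u = u -> S u.
Proof.
move=> Yu; have := @S_orb u 1 0 0 isT Yu.
by rewrite big_ord_recl big_ord0 addr0.
Qed.

(** * The shift case: every place is aperiodic *)

Section Shift.
Hypothesis xE : forall p, x p = p \Po ('X + 1).
Hypothesis natL : forall n, n.+1%:R != 0 :> L.

Lemma iter_shift k d : iter k x d = d \Po ('X + k%:R%:P).
Proof.
elim: k => [|k IH]; first by rewrite rmorph0 addr0 comp_polyXr.
rewrite iterS IH xE -comp_polyA comp_polyD comp_polyX comp_polyC.
by rewrite -addrA -[1]/(1%:P) -polyCD -natr1 [1 + _]addrC.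
Qed.

(** If d(x + k) = c d(x), the leading coefficients give c = 1. Then [d] takes the value d(0) at all
    multiples of k, which are infinitely many in characteristic zero, so [d] would be constant. *)
Lemma aperiodic_shift d : irreducible_poly d -> aperiodic d.
Proof.
move=> irr; split=> // k k0; apply/negP; rewrite iter_shift => /eqpf_eq[c _ E].
have c1 : c = 1.
  have := congr1 lead_coef E.
  rewrite lead_coef_comp ?size_XaddC // lead_coefXaddC expr1n mulr1 lead_coefZ.
  move=> Ec; apply: (@mulIf _ (lead_coef d)); last by rewrite -Ec mul1r.
  by rewrite lead_coef_eq0 irredp_neq0.
have step j : d.[(j * k)%:R] = d.[0].
  elim: j => [|j IH]; first by rewrite mul0n.
  rewrite mulSn addnC natrD -IH.
  have E1 : d \Po ('X + k%:R%:P) = d by rewrite E c1 scale1r.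
  by rewrite -[in RHS]E1 horner_comp hornerD hornerX hornerC.
pose p := d - d.[0]%:P.
have p0 : p != 0.
  apply: contraL irr.1; rewrite subr_eq0 => /eqP->.
  by rewrite size_polyC -leqNgt; case: eqP.
have lt_inj i j : (i < j)%N -> (i * k)%:R <> (j * k)%:R :> L.
  move=> ij E'; have := natL ((j * k - i * k).-1); rewrite prednK; last first.
    by rewrite subn_gt0 ltn_pmul2r.
  by rewrite natrB ?leq_mul2r 1?ltnW ?orbT // E' subrr eqxx.
(* As many distinct roots as the size of [p] are one more than its degree allows. *)
have := @max_poly_roots _ p (mkseq (fun j => (j * k)%:R) (size p)) p0.
rewrite size_mkseq ltnn => H; suff: false by []; apply: H.
  apply/allP => _ /mapP[j _ ->]; rewrite rootE hornerD hornerN hornerC step.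
  by rewrite subrr.
apply/mkseq_uniq => i j /= E'.
by case: (ltngtP i j) => // /lt_inj; rewrite E'.
Qed.

(** By linearity it suffices to treat monomials, by strong induction: the difference of x^(n+1) is
    (n+1) x^n plus terms of lower degree, and n + 1 is invertible. *)
Lemma antidifference p : exists h, p = x h - h.
Proof.
pose D p := exists h, p = x h - h.
have D0 : D 0 by exists 0; rewrite rmorph0 subr0.
have DD p1 p2 : D p1 -> D p2 -> D (p1 + p2).
  by move=> [h1 ->] [h2 ->]; exists (h1 + h2); rewrite rmorphD opprD addrACA.
have DZ c p1 : D p1 -> D (c *: p1).
  by move=> [h ->]; exists (c *: h); rewrite !xE linearZ scalerBr.
have DX n : D 'X^n.
  elim/ltn_ind: n => n IH.
  have E : x 'X^(n.+1) - 'X^(n.+1)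
      = \sum_(i < n) 'C(n.+1, i)%:R *: 'X^i + n.+1%:R *: 'X^n.
    rewrite xE comp_Xn_poly exprD1n !big_ord_recr /= binn binSn mulr1n addrK.
    by rewrite scaler_nat; congr (_ + _); apply: eq_bigr => i _; rewrite scaler_nat.
  have -> : 'X^n = n.+1%:R^-1 *: ((x 'X^(n.+1) - 'X^(n.+1))
      + (-1) *: \sum_(i < n) 'C(n.+1, i)%:R *: 'X^i).
    by rewrite E scaleN1r addrAC subrr add0r scalerA mulVf ?scale1r.
  apply/DZ/DD; first by exists 'X^(n.+1).
  by apply/DZ; apply: big_ind => // i _; apply/DZ/IH.
rewrite -/(D p) -[p]coefK poly_def.
by apply: big_ind => // i _; apply/DZ/DX.
Qed.

(** No irreducible factor can remain in the reduced denominator of v - g, so this is a polynomial in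
    x, hence a difference. *)
Theorem shift_coinv_fixed v : coinv_fixed X Y v -> S v.
Proof.
move=> /regular_decomposition[g Sg Hg]; rewrite -[v](subrK g); apply: S_D => //.
have [a [m [m0 wE Hm]]] := regular_denominator iota_inj iota_frac (v - g).
have [/eqP s1|s1] := eqVneq (size m) 1; last first.
  have [d irr dm] := irredp_exists s1.
  by case: (Hm d irr dm); apply/Hg/aperiodic_shift.
have [c c0 mE] := size_poly1P _ s1; have [h hE] := antidifference (c^-1 *: a).
rewrite wE; have -> : iota a / iota m = X (iota h) - iota h; last exact: S_dx.
rewrite -iota_x -rmorphB -hE mE -[a in LHS](scalerKV c0) -[in LHS]mul_polyC.
by rewrite rmorphM mulrAC divff ?mul1r // (iota_eq0 iota_inj) polyC_eq0.
Qed.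
End Shift.

(** * The q-shift case: only the place x = 0 is periodic *)

Section QShift.
Variable q : L.
Hypotheses (q0 : q != 0) (q_nroot : forall m, (0 < m)%N -> q ^+ m != 1).
Hypothesis xE : forall p, x p = p \Po (q *: 'X).

Lemma expr_q_inj : injective (fun k => q ^+ k).
Proof.
have H i j : (i < j)%N -> q ^+ i <> q ^+ j.
  move=> ij E; have := @q_nroot (j - i)%N; rewrite subn_gt0 => /(_ ij)/eqP.
  by apply; apply: (mulIf (expf_neq0 i q0)); rewrite mul1r -exprD subnK // ltnW.
by move=> i j E; case: (ltngtP i j) => // /H; rewrite E.
Qed.

Lemma coef_x p i : (x p)`_i = p`_i * q ^+ i.
Proof.
have -> : x p = \poly_(j < size p) (p`_j * q ^+ j).
  rewrite xE comp_polyE poly_def; apply: eq_bigr => j _.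
  by rewrite exprZn scalerA.
by rewrite coef_poly; case: ltnP => // H; rewrite nth_default ?mul0r.
Qed.

Lemma coef_iter_x k p i : (iter k x p)`_i = p`_i * q ^+ (k * i).
Proof.
elim: k => [|k IH]; first by rewrite mul0n mulr1.
by rewrite iterS coef_x IH -mulrA -exprD mulSn addnC.
Qed.

(** When [d] is not associate to x its constant coefficient is nonzero, which forces the factor c to
    be 1. The leading coefficient then makes [q] a root of unity. *)
Lemma aperiodic_q d : irreducible_poly d -> ~~ (d %= 'X) -> aperiodic d.
Proof.
move=> irr ndX; split=> // k k0; apply/negP => /eqpf_eq[c _ E].
have d00 : d`_0 != 0.
  apply: contra ndX => d00; rewrite eqp_sym; apply: irr.2.
    by rewrite size_polyX.
  by rewrite -['X]subr0 dvdp_XsubCl rootE horner_coef0.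
have Ei i : d`_i * q ^+ (k * i) = c * d`_i by rewrite -coef_iter_x E coefZ.
have c1 : c = 1.
  by apply: (mulIf d00); rewrite -Ei muln0 mulr1 mul1r.
have lc0 : lead_coef d != 0 by rewrite lead_coef_eq0 irredp_neq0.
have := Ei (size d).-1; rewrite -/(lead_coef d) c1 mulrC => /(mulIf lc0) /eqP.
by apply/negP/q_nroot; rewrite muln_gt0 k0 -subn1 subn_gt0 irr.1.
Qed.

Lemma coefM_top (p r : {poly L}) i j :
  (size p <= i.+1)%N -> (size r <= j.+1)%N -> (p * r)`_(i + j) = p`_i * r`_j.
Proof.
move=> sp sr; have hi : (i < (i + j).+1)%N by rewrite ltnS leq_addr.
rewrite coefM (bigD1 (Ordinal hi)) //= addKn big1 ?addr0 // => l li.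
have [il|il] := ltnP i l; first by rewrite nth_default ?mul0r ?(leq_trans sp).
have {il li} : (l < i)%N by rewrite ltn_neqAle il andbT -(inj_eq val_inj) in li *.
move=> li; rewrite [r`__]nth_default ?mulr0 //; apply: leq_trans sr _.
by rewrite ltn_subRL ltn_add2r.
Qed.

(** With u = n / m, clearing denominators gives e m(qx) m(x) = n(qx) m(x) - n(x) m(qx), and the top
    coefficients of the two sides are incompatible unless e = 0. *)
Lemma constant_not_dx e u : iota e%:P = X u - u -> e = 0.
Proof.
have [n [m [m0 ->]]] := iota_frac u.
have xm0 : x m != 0 by rewrite -size_poly_eq0 x_size size_poly_eq0.
rewrite fmorph_div -!iota_x subf_div ?(iota_eq0 iota_inj) // => /eqP.
rewrite eq_sym -[iota e%:P]divr1 -(rmorph1 iota) eqr_div; last 2 first.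
- by rewrite -rmorphM (iota_eq0 iota_inj) mulf_neq0.
- by rewrite rmorph1 oner_neq0.
rewrite rmorph1 mulr1 -!rmorphM -rmorphB (inj_eq iota_inj) => /eqP E.
apply/eqP/negPn/negP => e0.
pose b := (size m).-1.
have sm : (size m = b.+1)%N by rewrite prednK // size_poly_gt0.
have mb0 : m`_b != 0 by rewrite -/(lead_coef m) lead_coef_eq0.
(* If deg n <= deg m = b, the right side has no term of degree 2b because its two contributions
   cancel, while the left side has one. *)
have [nm|nm] := leqP (size n) (size m).
  have := congr1 (fun p : {poly L} => p`_(b + b)) E.
  rewrite coefB coefCM !coefM_top ?x_size ?sm // -?sm //.
  rewrite !coef_x [n`_b * (m`_b * _)]mulrA [X in X - _]mulrAC subrr.
  move=> /esym/eqP.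
  by rewrite !mulf_eq0 (negPf e0) (negPf mb0) expf_eq0 (negPf q0) andbF.
pose a := (size n).-1.
have n0 : n != 0 by apply: contraTneq nm => ->; rewrite size_poly0.
have sn : (size n = a.+1)%N by rewrite prednK // size_poly_gt0.
have na0 : n`_a != 0 by rewrite -/(lead_coef n) lead_coef_eq0.
have ba : (b < a)%N by rewrite -ltnS -sm -sn.
(* Here a > b, so the left side has degree 2b < a + b, while the right side has the coefficient n_a
   m_b (q^a - q^b), which is nonzero. *)
have := congr1 (fun p : {poly L} => p`_(a + b)) E.
rewrite coefB coefCM [(x m * m)`__]nth_default; last first.
  apply: leq_trans (size_polyMleq _ _) _.
  by rewrite x_size sm /= addnS -addSn leq_add2r.
rewrite !coefM_top ?x_size ?sm ?sn // mulr0 !coef_x => H.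
have : n`_a * m`_b * (q ^+ a - q ^+ b) = 0 by
  rewrite mulrBr [X in X - _]mulrAC -[_ * q ^+ b]mulrA H.
move/eqP; rewrite !mulf_eq0 (negPf na0) (negPf mb0) subr_eq0 /=.
by move=> /eqP/expr_q_inj ab; rewrite ab ltnn in ba.
Qed.

(** The denominator of v - g can only be a constant times a power of x. In this Laurent polynomial
    each monomial of nonzero exponent is a difference, and the constant term [e] turns out to be
    fixed by [Y]. *)
Theorem q_coinv_fixed v : coinv_fixed X Y v -> S v.
Proof.
move=> fv; have [g Sg Hg] := regular_decomposition fv.
rewrite -[v](subrK g); apply: S_D => //.
have [a [m [m0 wE Hm]]] := regular_denominator iota_inj iota_frac (v - g).
have irrX : irreducible_poly ('X : {poly L}).
  by rewrite -['X]subr0; apply: irredp_XsubC.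
have [k [m1 [mE m1X]]] := dvdp_max_power irrX m0.
have [s1|s1] := boolP (size m1 == 1); last first.
  have [d irr dm] := irredp_exists s1.
  case: (Hm d irr); first by rewrite mE dvdp_mulr.
  apply/Hg/aperiodic_q => //; apply: contra m1X => /eqp_dvdl <- //.
have [c c0 m1E] := size_poly1P _ s1.
have [p pE] : exists p, p = c^-1 *: a by exists (c^-1 *: a).
(* Solves q^-k h(qx) - h(x) = p coefficient by coefficient. At i = k the divisor is 0, so the
   convention for division by 0 makes this coefficient of [h] vanish and [e] is left over. *)
pose h := \poly_(i < size p) (p`_i / (q ^+ i / q ^+ k - 1)).
pose e := p`_k.
have qk0 : q ^+ k != 0 by rewrite expf_neq0.
have Xk0 : 'X^k != 0 :> {poly L} by rewrite expf_neq0 ?polyX_eq0.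
have cX0 : c%:P * 'X^k != 0 by rewrite -m1E -mE.
have iX0 : iota 'X^k != 0 by rewrite (iota_eq0 iota_inj).
have ph : p = (q ^- k) *: x h - h + e *: 'X^k.
  apply/polyP => i; rewrite !(coefD, coefN, coefZ) coef_x coefXn coef_poly.
  have [->|ik] := eqVneq i k.
    by rewrite divff // subrr invr0 mulr0 if_same mul0r mulr0 subr0 add0r mulr1.
  rewrite mulr0 addr0; case: ltnP => ip; last first.
    by rewrite nth_default // mul0r mulr0 subr0.
  have qik : q ^+ i / q ^+ k - 1 != 0.
    rewrite subr_eq0; apply: contra ik => /eqP E; apply/eqP/expr_q_inj => /=.
    by rewrite -[LHS](divfK qk0) E mul1r.
  have rescale (A B C D : L) : C * (A / D * B) - A / D = A / D * (B * C - 1).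
    by rewrite mulrBr mulr1 [C * _]mulrC mulrA.
  by rewrite rescale divfK.
have wE' : v - g = X (iota h / iota 'X^k) - iota h / iota 'X^k + iota e%:P.
  have -> : v - g = iota p / iota 'X^k.
    apply/eqP; rewrite wE mE m1E eqr_div ?(iota_eq0 iota_inj) //.
    rewrite -!rmorphM (inj_eq iota_inj) pE mulrA -scalerAl [a * c%:P]mulrC.
    by rewrite mul_polyC scalerA mulVf ?scale1r.
  have xX : x 'X^k = q ^+ k *: 'X^k by rewrite xE comp_Xn_poly exprZn.
  rewrite fmorph_div -!iota_x xX {1}ph rmorphD rmorphB mulrDl mulrBl.
  congr (_ - _ + _); last first.
    by rewrite -mul_polyC rmorphM mulfK.
  apply/eqP; rewrite eqr_div ?(iota_eq0 iota_inj) ?scaler_eq0 ?negb_or ?qk0 //.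
  rewrite -!rmorphM (inj_eq iota_inj) -scalerAl -scalerAr scalerA.
  by rewrite mulVf ?scale1r.
have Se : coinv_fixed X Y (iota e%:P).
  rewrite -[iota e%:P](addKr (X (iota h / iota 'X^k) - iota h / iota 'X^k)).
  rewrite -wE' addrC; have fB := coinv_fixedB (rmorphB X) (rmorphB Y).
  apply/fB; last exact: coinv_fixed_dx (rmorphB X) (rmorphB Y) XYC _.
  by apply: fB => //; apply: S_fixed.
rewrite wE'; apply: S_D; first exact: S_dx.
apply: S_fix; have [u uE] := Se.
(* As [y] preserves sizes, Y e is again an element of [L]. So Y e - e is an element of [L] that is
   also a difference, hence 0. *)
have ye : y e%:P = ((y e%:P)`_0)%:P.
  by apply: size1_polyC; rewrite y_size size_polyC leq_b1.
have : (y e%:P)`_0 - e = 0.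
  by apply: (@constant_not_dx _ u); rewrite polyCB rmorphB /= -ye iota_y.
by move/eqP; rewrite subr_eq0 -iota_y ye coefC => /eqP ->.
Qed.
End QShift.

End Places.

(** * Representable pairs *)

Section Representations.
Variables (K : fieldType) (theta_x theta_y : operator K).
Implicit Types (f g a b u v h : {ratfun K}).
Local Notation X := (op theta_x).
Local Notation Y := (op theta_y).

(** Generating the pairs inductively avoids indexed families until the end; [represented_sum]
    recovers the form stated in the theorem. *)
Inductive represented : {ratfun K} -> {ratfun K} -> Prop :=
| Rep_exact a : represented (partial theta_y a) (partial theta_x a)
| Rep_orbit b (s : nat) (t : int) :
    op_pow theta_x s%:Z b = op_pow theta_y t b -> ~ (s = 0%N /\ t = 0) ->
    represented (op_quot theta_x s%:Z b) (op_quot theta_y t b)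
| Rep_add f1 g1 f2 g2 :
    represented f1 g1 -> represented f2 g2 -> represented (f1 + f2) (g1 + g2).

Hypotheses (X_zm : zmod_morphism X) (Y_zm : zmod_morphism Y).
Hypothesis XYC : forall f, X (Y f) = Y (X f).

Lemma represented_sum f g : represented f g ->
  exists a n (b : 'I_n -> {ratfun K}) (s : 'I_n -> nat) (t : 'I_n -> int),
    [/\ f = partial theta_y a + \sum_(i < n) op_quot theta_x (s i)%:Z (b i),
        g = partial theta_x a + \sum_(i < n) op_quot theta_y (t i) (b i)
      & forall i : 'I_n,
          op_pow theta_x (s i)%:Z (b i) = op_pow theta_y (t i) (b i)
          /\ ~ (s i = 0%N /\ t i = 0)].
Proof.
have dx0 : partial theta_x 0 = 0 by rewrite /partial (zm0 X_zm) subrr.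
have dy0 : partial theta_y 0 = 0 by rewrite /partial (zm0 Y_zm) subrr.
elim=> [a|b s t E nz|f1 g1 f2 g2 _ IH1 _ IH2].
- exists a, 0, (fun=> 0), (fun=> 0), (fun=> 0).
  by rewrite !big_ord0 !addr0; split=> // -[].
- exists 0, 1, (fun=> b), (fun=> s), (fun=> t).
  by rewrite dx0 dy0 !add0r !big_ord1; split.
have [a1 [n1 [b1 [s1 [t1 [-> -> H1]]]]]] := IH1.
have [a2 [n2 [b2 [s2 [t2 [-> -> H2]]]]]] := IH2.
pose glue T (c1 : 'I_n1 -> T) (c2 : 'I_n2 -> T) (i : 'I_(n1 + n2)) :=
  match split i with inl j => c1 j | inr j => c2 j end.
have glueL T c1 c2 j : @glue T c1 c2 (lshift n2 j) = c1 j.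
  by rewrite /glue -[lshift n2 j]/(unsplit (inl j)) unsplitK.
have glueR T c1 c2 j : @glue T c1 c2 (rshift n1 j) = c2 j.
  by rewrite /glue -[rshift n1 j]/(unsplit (inr j)) unsplitK.
exists (a1 + a2), (n1 + n2)%N, (glue _ b1 b2), (glue _ s1 s2), (glue _ t1 t2).
split=> [||i]; last by rewrite /glue; case: (split i).
- rewrite big_split_ord /= addrACA; congr (_ + _).
    by rewrite /partial (zmD Y_zm) opprD addrACA.
  by congr (_ + _); apply: eq_bigr => i _; rewrite ?glueL ?glueR.
rewrite big_split_ord /= addrACA; congr (_ + _).
  by rewrite /partial (zmD X_zm) opprD addrACA.
by congr (_ + _); apply: eq_bigr => i _; rewrite ?glueL ?glueR.
Qed.

Lemma partial_op_quot (theta : operator K) (n : int) f : zmod_morphism theta ->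
  partial theta (op_quot theta n f) = op_pow theta n f - f.
Proof.
move=> tz; rewrite /partial; case: n => m /=.
  elim: m => [|m IH]; first by rewrite big_geq // (zm0 tz) !subrr.
  by rewrite big_nat_recr //= (zmD tz) opprD addrACA IH addrC subrKA.
elim: m => [|m IH].
  by rewrite big_nat1 /= (zmN tz) op_invK opprK addrC.
rewrite big_nat_recr // -NegzE /=.
set c := iter m _ _; set sm := \sum_(_ <= _ < _) _ in IH *.
rewrite opprD (zmD tz) [theta (- op_inv _ _)](zmN tz) op_invK.
rewrite opprK in IH; rewrite -[theta (- sm)](addrK sm) IH /=; ring.
Qed.

(** This is the converse of the theorem. For an orbit term the two sides telescope to theta_x^s b -
    b and theta_y^t b - b, which agree. *)
Lemma represented_compat f g :
  represented f g -> partial theta_x f = partial theta_y g.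
Proof.
elim=> [a|b s t E nz|f1 g1 f2 g2 _ IH1 _ IH2].
- by rewrite /partial (zmB X_zm) (zmB Y_zm) XYC addrBBC.
- by rewrite !partial_op_quot // E.
rewrite /partial (zmD X_zm) (zmD Y_zm) !opprD.
by rewrite [LHS]addrACA [RHS]addrACA; congr (_ + _).
Qed.

(** Instantiates the abstract [S]: the main work concerns [g] alone, and [f] is adjusted afterwards
    by [represented_kernel]. *)
Definition representable g := exists f, represented f g.

Lemma representableD g1 g2 :
  representable g1 -> representable g2 -> representable (g1 + g2).
Proof. by move=> [f1 R1] [f2 R2]; exists (f1 + f2); apply: Rep_add. Qed.

Lemma representable_dx a : representable (X a - a).
Proof. by exists (partial theta_y a); apply: Rep_exact. Qed.

Lemma representable_fixed g : representable g -> coinv_fixed X Y g.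
Proof. by move=> [f /represented_compat E]; exists f. Qed.

Lemma representable_orbit b t k l : (0 < t)%N ->
  iter k X (iter t Y b) = iter l X b -> representable (\sum_(j < t) iter j Y b).
Proof.
move=> t0 E; have [kl|lk] := leqP k l.
  exists (op_quot theta_x (l - k)%N b).
  have -> : \sum_(j < t) iter j Y b = op_quot theta_y t b by rewrite /= big_mkord.
  apply: Rep_orbit; last by case=> _ [tt0]; rewrite tt0 in t0.
  by apply: (can_inj (iterK k (opK theta_x))); rewrite /= E -iterD subnKC.
(* The exponent of theta_x must not be negative. When k > l the relation is read backward:
   theta_x^(k-l) c = - b = theta_y^(-t) c, and the quotient for -t applied to [c] is again the sum
   of the Y^j b, with the summands reversed. *)
pose c := - iter t Y b.
have Y'_zm := can_zm Y_zm (opK theta_y) (op_invK theta_y).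
exists (op_quot theta_x (k - l)%N c).
have -> : \sum_(j < t) iter j Y b = op_quot theta_y (Negz t.-1) c.
  rewrite /= big_add1 /= big_mkord -sumrN prednK //.
  rewrite (reindex_inj rev_ord_inj) /=; apply: eq_bigr => j _.
  rewrite -iterS /c (zmN (iter_zm _ Y'_zm)) opprK.
  apply: (can_inj (iterK j.+1 (opK theta_y))).
  by rewrite (iterK j.+1 (op_invK theta_y)) -iterD subnKC.
apply: Rep_orbit; last by case.
rewrite /= -iterS prednK // /c (zmN (iter_zm _ X_zm)) (zmN (iter_zm _ Y'_zm)).
rewrite (iterK t (opK theta_y)); congr (- _).
apply: (can_inj (iterK l (opK theta_x))).
by rewrite -E -iterD subnKC // ltnW.
Qed.

(** Two first components for the same [g] differ by some [b] fixed by theta_x; the orbit term with s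
    = 1 and t = 0 represents the pair (b, 0). *)
Lemma represented_kernel f g f' : represented f' g ->
  partial theta_x f = partial theta_y g -> represented f g.
Proof.
move=> R E; have C := represented_compat R.
rewrite -[f](subrK f') -[g]add0r; apply: Rep_add R.
pose b := f - f'; have Xb : X b = b.
  apply/eqP; rewrite -subr_eq0 /b (zmB X_zm) addrBBC.
  by rewrite -/(partial theta_x f) E -C subrr.
have := @Rep_orbit b 1 0; rewrite /= big_nat1 big_geq //.
by apply=> // -[].
Qed.
End Representations.

(** * Substitutions on L(x) *)

Lemma scale_polyC_mul (R : comNzRingType) (c d l n : R) : l * d = n ->
  (c * d) *: l%:P = c%:P * n%:P.
Proof. by move=> <-; rewrite -mul_polyC -!polyCM -mulrA [d * l]mulrC. Qed.

(** * Extension of injective morphisms to fraction fields *)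

Section FractionLift.
Variables (R : idomainType) (E : fieldType).
Implicit Types (a b d : R) (f g : {fraction R}).

Lemma fraction_repr f :
  f = FracField.tofrac \n_(repr f) / FracField.tofrac \d_(repr f).
Proof.
have d0 : FracField.tofrac \d_(repr f) != 0.
  by rewrite tofrac_eq0 denom_ratioP.
apply: (mulIf d0); rewrite divfK // -[X in X * _ = _]reprK.
move: (repr f) => r; unlock FracField.tofrac; rewrite -[LHS]FracField.pi_mul.
apply/eqmodP; rewrite /= FracField.equivfE /FracField.mulf.
by rewrite !numden_Ratio ?mulf_neq0 ?oner_neq0 ?denom_ratioP // !mulr1 mulrC.
Qed.

Lemma fraction_rmorph_eq (h1 h2 : {rmorphism {fraction R} -> E}) :
  (forall a, h1 (FracField.tofrac a) = h2 (FracField.tofrac a)) -> h1 =1 h2.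
Proof. by move=> H f; rewrite (fraction_repr f) !fmorph_div !H. Qed.

Variable phi : {rmorphism R -> E}.
Hypothesis phi_inj : injective phi.

Let phi_eq0 a : (phi a == 0) = (a == 0).
Proof. by rewrite -(inj_eq phi_inj) rmorph0. Qed.

Definition fraction_lift of injective phi := fun f : {fraction R} =>
  phi \n_(repr f) / phi \d_(repr f).
Local Notation lift := (fraction_lift phi_inj).

Lemma fraction_lift_div a d : d != 0 ->
  lift (FracField.tofrac a / FracField.tofrac d) = phi a / phi d.
Proof.
move=> d0; set f := _ / _; have := fraction_repr f; rewrite /fraction_lift.
have := denom_ratioP (repr f).
move: (\n_(repr f)) (\d_(repr f)) => n e e0 /eqP.
rewrite /f eqr_div ?tofrac_eq0 // -!rmorphM tofrac_eq => /eqP Ef.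
by apply/eqP; rewrite eqr_div ?phi_eq0 // -!rmorphM -Ef.
Qed.

Lemma fraction_lift_tofrac a : lift (FracField.tofrac a) = phi a.
Proof.
rewrite -[FracField.tofrac a]divr1 -(rmorph1 (@FracField.tofrac R)).
by rewrite fraction_lift_div ?oner_neq0 // rmorph1 divr1.
Qed.

Lemma fraction_lift_zmod : zmod_morphism lift.
Proof.
move=> f g; rewrite [f]fraction_repr [g]fraction_repr.
move: (denom_ratioP (repr f)) (denom_ratioP (repr g)).
move: (\n_(repr f)) (\d_(repr f)) (\n_(repr g)) (\d_(repr g)) => a b c d b0 d0.
rewrite subf_div ?tofrac_eq0 // -!rmorphM -rmorphB.
rewrite !fraction_lift_div ?mulf_neq0 // subf_div ?phi_eq0 //.
by rewrite rmorphB !rmorphM.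
Qed.

Lemma fraction_lift_monoid : monoid_morphism lift.
Proof.
split=> [|f g].
  by rewrite -(rmorph1 (@FracField.tofrac R)) fraction_lift_tofrac rmorph1.
rewrite [f]fraction_repr [g]fraction_repr.
move: (denom_ratioP (repr f)) (denom_ratioP (repr g)).
move: (\n_(repr f)) (\d_(repr f)) (\n_(repr g)) (\d_(repr g)) => a b c d b0 d0.
rewrite mulf_div -!rmorphM !fraction_lift_div ?mulf_neq0 //.
by rewrite mulf_div -!rmorphM.
Qed.

HB.instance Definition _ :=
  GRing.isZmodMorphism.Build {fraction R} E lift fraction_lift_zmod.
HB.instance Definition _ :=
  GRing.isMonoidMorphism.Build {fraction R} E lift fraction_lift_monoid.
End FractionLift.

(** * K(x,y) as the field of fractions of L[x] with L = K(y) *)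

Section Tower.
Variable K : fieldType.
Local Notation L := {fraction {poly K}}.
Local Notation F := {ratfun K}.
Local Notation tofrac := FracField.tofrac.
Implicit Types (a c : {poly K}) (n p : {poly {poly K}}) (f : F).

Let emb_poly : {rmorphism {poly K} -> F} := @FracField.tofrac _ \o polyC.
Let emb_poly_inj : injective emb_poly.
Proof.
by move=> a c /= /eqP; rewrite tofrac_eq => /eqP/polyC_inj.
Qed.

Definition emb : {rmorphism L -> F} := fraction_lift emb_poly_inj.
Lemma emb_tofrac a : emb (tofrac a) = tofrac a%:P.
Proof. exact: fraction_lift_tofrac. Qed.

(** Plays the role of the abstract [iota]: the inclusion of L[x] into K(x,y). *)
Definition poly_emb : {rmorphism {poly L} -> F} :=
  horner_eval (rx K) \o map_poly emb.

Lemma poly_embX : poly_emb 'X = rx K.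
Proof. by rewrite /= /horner_eval map_polyX hornerX. Qed.
Lemma poly_embC l : poly_emb l%:P = emb l.
Proof. by rewrite /= /horner_eval map_polyC hornerC. Qed.

Lemma poly_emb_map p : poly_emb (map_poly (@tofrac _) p) = tofrac p.
Proof.
pose h : {rmorphism {poly {poly K}} -> F} := poly_emb \o map_poly (@tofrac _).
have hX : h 'X = rx K by rewrite /h /= map_polyX; exact: poly_embX.
have hC a : h a%:P = tofrac a%:P.
  by rewrite /h /= map_polyC; rewrite -[LHS]/(poly_emb _) poly_embC emb_tofrac.
have := @bieval_unique K h; rewrite hX hC => H.
by rewrite -[LHS]/(h p) H ?bieval_xy.
Qed.

Lemma poly_emb_frac f :
  exists a b : {poly L}, b != 0 /\ f = poly_emb a / poly_emb b.
Proof.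
exists (map_poly (@tofrac _) \n_(repr f)), (map_poly (@tofrac _) \d_(repr f)).
split; last by rewrite !poly_emb_map -ratfun_repr.
apply/eqP => /(congr1 poly_emb)/eqP.
by rewrite poly_emb_map rmorph0 tofrac_eq0 (negPf (denom_ratioP _)).
Qed.

Lemma clear_denominators (u : {poly L}) : exists c n,
  c != 0 /\ tofrac c *: u = map_poly (@tofrac _) n.
Proof.
elim/poly_ind: u => [|u l [c [n [c0 E]]]].
  by exists 1, 0; rewrite oner_neq0 scaler0 rmorph0.
pose d := \d_(repr l); have d0 : d != 0 by apply: denom_ratioP.
exists (c * d), (d%:P * n * 'X + (c * \n_(repr l))%:P).
rewrite mulf_neq0 // rmorphD !rmorphM /= map_polyX !map_polyC /= -E; split=> //.
rewrite scalerDr; congr (_ + _).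
  by rewrite mul_polyC scalerA -scalerAl [tofrac d * _]mulrC.
have dl : l * tofrac d = tofrac \n_(repr l).
  have := congr1 ( *%R^~ (tofrac d)) (fraction_repr l).
  by rewrite /= divfK ?tofrac_eq0.
exact: scale_polyC_mul.
Qed.

(** A nonzero multiple from K[y] brings [u] into K[y][x], where the embedding is the inclusion into
    the field of fractions. *)
Lemma poly_emb_inj : injective poly_emb.
Proof.
apply: raddf_inj => u u0; have [c [n [c0 E]]] := clear_denominators u.
have tc0 : tofrac c != 0 by rewrite tofrac_eq0.
have : poly_emb (tofrac c *: u) = 0 by rewrite -mul_polyC rmorphM u0 mulr0.
rewrite E poly_emb_map => /eqP; rewrite tofrac_eq0 => /eqP n0.
apply/eqP; move/eqP: E; rewrite n0 rmorph0 scaler_eq0 (negPf tc0); exact.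
Qed.

Lemma poly_rmorph_eq (E : fieldType) (h1 h2 : {rmorphism {poly L} -> E}) :
  (forall a, h1 (tofrac a)%:P = h2 (tofrac a)%:P) -> h1 'X = h2 'X -> h1 =1 h2.
Proof.
move=> HC HX; elim/poly_ind => [|u l IH]; first by rewrite !rmorph0.
rewrite !rmorphD !rmorphM IH HX; congr (_ + _).
pose g1 : {rmorphism L -> E} := h1 \o polyC.
pose g2 : {rmorphism L -> E} := h2 \o polyC.
exact: (@fraction_rmorph_eq _ _ g1 g2).
Qed.

Section YAction.
Variable V : {poly K}.
Hypothesis sV : size V = 2.
Let sub_y : {rmorphism {poly K} -> L} := @FracField.tofrac _ \o comp_poly V.
Let sub_y_inj : injective sub_y.
Proof.
apply: raddf_inj => a /= /eqP; rewrite tofrac_eq0 comp_poly2_eq0 //.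
by move/eqP.
Qed.
Definition coef_y : {rmorphism L -> L} := fraction_lift sub_y_inj.
Lemma coef_y_tofrac a : coef_y (tofrac a) = tofrac (a \Po V).
Proof. exact: fraction_lift_tofrac. Qed.
End YAction.

Lemma coef_yK (V V' : {poly K}) (sV : size V = 2) (sV' : size V' = 2) :
  V' \Po V = 'X -> cancel (coef_y sV') (coef_y sV).
Proof.
move=> VV'; apply: (@fraction_rmorph_eq _ _ (coef_y sV \o coef_y sV') idfun) => a.
by rewrite /= !coef_y_tofrac -comp_polyA VV' comp_polyXr.
Qed.
End Tower.

(** * Affine substitutions as instances of the abstract automorphisms *)

Section Affine.
Variable K : closedFieldType.
Hypothesis charK : [pchar K] =i pred0.
Local Notation L := {fraction {poly K}}.
Local Notation F := {ratfun K}.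
Local Notation tofrac := FracField.tofrac.

Variables (theta_x theta_y : operator K) (Ux : {poly {poly K}}) (V V' : {poly K}).
Variables (U U' : {poly L}).
Hypotheses (X_zm : zmod_morphism theta_x) (X_mm : monoid_morphism theta_x).
Hypotheses (Y_zm : zmod_morphism theta_y) (Y_mm : monoid_morphism theta_y).
Hypothesis X_tofrac : forall p, theta_x (tofrac p) = tofrac (p \Po Ux).
Hypothesis Y_tofrac :
  forall p, theta_y (tofrac p) = tofrac (map_poly (comp_poly V) p).
Hypotheses (UxV : map_poly (comp_poly V) Ux = Ux).
Hypotheses (sV : size V = 2) (sV' : size V' = 2) (V'V : V' \Po V = 'X).
Hypotheses (sU : size U = 2) (U'U : U' \Po U = 'X) (UU' : U \Po U' = 'X).
Hypothesis embU : poly_emb K U = tofrac Ux.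

Let X : {rmorphism F -> F} := HB.pack (op theta_x)
  (GRing.isZmodMorphism.Build _ _ _ X_zm)
  (GRing.isMonoidMorphism.Build _ _ _ X_mm).
Let Y : {rmorphism F -> F} := HB.pack (op theta_y)
  (GRing.isZmodMorphism.Build _ _ _ Y_zm)
  (GRing.isMonoidMorphism.Build _ _ _ Y_mm).
Let x : {rmorphism {poly L} -> {poly L}} := comp_poly U.
Let x' : {rmorphism {poly L} -> {poly L}} := comp_poly U'.
Let y : {rmorphism {poly L} -> {poly L}} := map_poly (coef_y sV).
Let y' : {rmorphism {poly L} -> {poly L}} := map_poly (coef_y sV').

(** It suffices to compare on polynomials, and there the substitutions commute because the image
    [Ux] of x is fixed by the substitution for y. *)
Lemma thetaC f : X (Y f) = Y (X f).
Proof.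
pose h1 : {rmorphism F -> F} := X \o Y.
pose h2 : {rmorphism F -> F} := Y \o X.
apply: (@fraction_rmorph_eq _ _ h1 h2) => p.
rewrite /h1 /h2 /= Y_tofrac !X_tofrac Y_tofrac.
by rewrite map_comp_poly UxV.
Qed.

Lemma emb_x p : poly_emb K (x p) = X (poly_emb K p).
Proof.
pose h1 : {rmorphism {poly L} -> F} := poly_emb K \o x.
pose h2 : {rmorphism {poly L} -> F} := X \o poly_emb K.
apply: (@poly_rmorph_eq _ _ h1 h2) => [a|]; rewrite /h1 /h2.
  rewrite -[LHS]/(poly_emb K (_ \Po U)) -[RHS]/(X (poly_emb K _)) comp_polyC.
  by rewrite poly_embC emb_tofrac -[RHS]/(theta_x _) X_tofrac comp_polyC.
rewrite -[LHS]/(poly_emb K (_ \Po U)) -[RHS]/(X (poly_emb K _)) comp_polyX.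
by rewrite poly_embX embU -[RHS]/(theta_x _) X_tofrac comp_polyX.
Qed.

Lemma emb_y p : poly_emb K (y p) = Y (poly_emb K p).
Proof.
pose h1 : {rmorphism {poly L} -> F} := poly_emb K \o y.
pose h2 : {rmorphism {poly L} -> F} := Y \o poly_emb K.
have yC l : y l%:P = (coef_y sV l)%:P := map_polyC _ _.
have yX : y 'X = 'X := map_polyX _.
apply: (@poly_rmorph_eq _ _ h1 h2) => [a|].
  rewrite -[LHS]/(poly_emb K (y (tofrac a)%:P)) yC poly_embC coef_y_tofrac.
  rewrite emb_tofrac -[RHS]/(theta_y (poly_emb K (tofrac a)%:P)) poly_embC.
  by rewrite emb_tofrac Y_tofrac map_polyC.
rewrite -[LHS]/(poly_emb K (y 'X)) yX -[RHS]/(theta_y (poly_emb K 'X)).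
by rewrite poly_embX /rx Y_tofrac map_polyX.
Qed.

Lemma xK : cancel x x'.
Proof. by move=> p; rewrite /x /x' /= -comp_polyA UU' comp_polyXr. Qed.
Lemma x'K : cancel x' x.
Proof. by move=> p; rewrite /x /x' /= -comp_polyA U'U comp_polyXr. Qed.
Lemma y'K : cancel y' y.
Proof.
move=> p; rewrite /y /y' /= -map_poly_comp; apply: map_poly_id => l _ /=.
exact: coef_yK.
Qed.
Lemma x_size p : size (x p) = size p.
Proof. exact: size_comp_poly2. Qed.
Lemma y_size p : size (y p) = size p.
Proof. exact: size_map_poly. Qed.

Lemma represented_of_coinv f g :
  (forall v, coinv_fixed theta_x theta_y v -> representable theta_x theta_y v) ->
  partial theta_x f = partial theta_y g -> represented theta_x theta_y f g.
Proof.
move=> H E; have [|f' R] := H g; first by exists f; rewrite -[LHS]/(partial _ _) -E.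
exact: (represented_kernel X_zm Y_zm thetaC R E).
Qed.

Lemma represented_shift f g : U = 'X + 1 ->
  partial theta_x f = partial theta_y g -> represented theta_x theta_y f g.
Proof.
move=> UE; apply: represented_of_coinv => v.
have natL n : n.+1%:R != 0 :> L.
  rewrite -(rmorph_nat (@FracField.tofrac {poly K})) tofrac_eq0.
  rewrite -(rmorph_nat (@polyC K)) polyC_eq0.
  by rewrite ((pcharf0P K).1 charK).
apply: (@shift_coinv_fixed L F (poly_emb K) (@poly_emb_inj K) (@poly_emb_frac K)
  X Y (op_inv theta_x) (op_inv theta_y) x x' y y' (opK theta_x) (op_invK theta_x)
  (opK theta_y) (op_invK theta_y) thetaC xK x'K y'K emb_x emb_y x_size y_size
  (representable theta_x theta_y)) => //.
- exact: representableD.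
- exact: representable_dx.
- exact: representable_orbit.
- by move=> p; rewrite -UE.
Qed.

Lemma represented_q (q : K) f g : q != 0 ->
  (forall m : nat, (0 < m)%N -> q ^+ m != 1) -> U = tofrac q%:P *: 'X ->
  partial theta_x f = partial theta_y g -> represented theta_x theta_y f g.
Proof.
move=> q0 q_nroot UE; apply: represented_of_coinv => v.
have [tq0 tq_nroot] : tofrac q%:P != 0 :> L /\
    forall m, (0 < m)%N -> tofrac q%:P ^+ m != 1 :> L.
  split=> [|m m0]; first by rewrite tofrac_eq0 polyC_eq0.
  rewrite -rmorphXn -(rmorph1 (@FracField.tofrac {poly K})) tofrac_eq.
  by rewrite -rmorphXn -(rmorph1 (@polyC K)) (inj_eq (@polyC_inj K)) q_nroot.
apply: (@q_coinv_fixed L F (poly_emb K) (@poly_emb_inj K) (@poly_emb_frac K)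
  X Y (op_inv theta_x) (op_inv theta_y) x x' y y' (opK theta_x) (op_invK theta_x)
  (opK theta_y) (op_invK theta_y) thetaC xK x'K y'K emb_x emb_y x_size y_size
  (representable theta_x theta_y) _ _ _ _ (tofrac q%:P)) => //.
- exact: representableD.
- exact: representable_dx.
- exact: representable_orbit.
- exact: representable_fixed X_zm Y_zm thetaC.
- by move=> p; rewrite -UE.
Qed.
End Affine.

Lemma affine_compK (R : comNzRingType) (a b a' b' : R) :
  a' * a = 1 -> a' * b + b' = 0 ->
  (a' *: 'X + b'%:P) \Po (a *: 'X + b%:P) = 'X.
Proof.
move=> aa b0; rewrite comp_polyD comp_polyZ comp_polyX comp_polyC scalerDr.
rewrite scalerA aa scale1r -addrA -[a' *: b%:P]mul_polyC -polyCM -polyCD b0.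
by rewrite addr0.
Qed.

Lemma size_affine (R : idomainType) (a b : R) : a != 0 ->
  size (a *: 'X + b%:P) = 2.
Proof.
by move=> a0; rewrite -mul_polyC size_MXaddC polyC_eq0 (negPf a0) /= size_polyC a0.
Qed.

(** * Shifts and q-shifts as affine substitutions *)

Section AffineOperators.
Variable K : fieldType.
Implicit Types (a b : K) (theta : operator K).

Definition affine_x theta a b :=
  op theta =1 rsubst (rcst a * rx K + rcst b) (ry K).
Definition affine_y theta a b :=
  op theta =1 rsubst (rx K) (rcst a * ry K + rcst b).

Lemma rcst_affine a b :
  rcst a * rx K + rcst b = FracField.tofrac (a%:P *: 'X + b%:P%:P).
Proof. by rewrite -(mul_polyC a%:P 'X) rmorphD rmorphM. Qed.

Definition frac_cst a : {fraction {poly K}} := FracField.tofrac a%:P.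

Lemma emb_frac_cst a : poly_emb K (frac_cst a)%:P = rcst a.
Proof. by rewrite poly_embC emb_tofrac. Qed.

Lemma poly_emb_affine a b :
  poly_emb K (frac_cst a *: 'X + (frac_cst b)%:P)
    = FracField.tofrac (a%:P *: 'X + b%:P%:P).
Proof.
rewrite -rcst_affine -(mul_polyC (frac_cst a) 'X).
rewrite (rmorphD (poly_emb K)) (rmorphM (poly_emb K)) poly_embX.
by congr (_ * _ + _); apply: emb_frac_cst.
Qed.

Lemma affine_x_morph theta a b : a != 0 -> affine_x theta a b ->
  [/\ zmod_morphism theta, monoid_morphism theta
    & forall p, theta (FracField.tofrac p)
        = FracField.tofrac (p \Po (a%:P *: 'X + b%:P%:P))].
Proof.
move=> a0 H; have I := @affine_inj_x K a b a0.
split=> [f g||p]; first by rewrite !H (rsubst_zmod I).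
  by split=> [|f g]; rewrite !H ?(rsubst_monoid I).1 ?(rsubst_monoid I).2.
by rewrite H rsubst_tofrac // rcst_affine; apply: bieval_comp_x.
Qed.

Lemma affine_y_morph theta a b : a != 0 -> affine_y theta a b ->
  [/\ zmod_morphism theta, monoid_morphism theta
    & forall p, theta (FracField.tofrac p)
        = FracField.tofrac (map_poly (comp_poly (a *: 'X + b%:P)) p)].
Proof.
move=> a0 H; have I := @affine_inj_y K a b a0.
split=> [f g||p]; first by rewrite !H (rsubst_zmod I).
  by split=> [|f g]; rewrite !H ?(rsubst_monoid I).1 ?(rsubst_monoid I).2.
have E : rcst a * ry K + rcst b = FracField.tofrac (a *: 'X + b%:P)%:P.
  by rewrite -(mul_polyC a 'X) polyCD polyCM rmorphD rmorphM.
by rewrite H rsubst_tofrac // E; apply: bieval_comp_y.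
Qed.

Lemma sigma_x_affine : affine_x sigma_x 1 1.
Proof. by move=> f; rewrite /affine_x -shiftE_x. Qed.
Lemma sigma_y_affine : affine_y sigma_y 1 1.
Proof. by move=> f; rewrite /affine_y -shiftE_y. Qed.
Lemma tau_x_affine q (q0 : q != 0) : affine_x (tau_x q0) q 0.
Proof. by move=> f; rewrite rmorph0 addr0. Qed.
Lemma tau_y_affine q (q0 : q != 0) : affine_y (tau_y q0) q 0.
Proof. by move=> f; rewrite rmorph0 addr0. Qed.
End AffineOperators.

Theorem theorem3 (K : closedFieldType) (charK : [pchar K] =i pred0)
    (q : K) (q0 : q != 0) (q_nroot : forall m : nat, (0 < m)%N -> q ^+ m != 1)
    (theta_x theta_y : operator K)
    (Htheta_x : theta_x = sigma_x \/ theta_x = tau_x q0)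
    (Htheta_y : theta_y = sigma_y \/ theta_y = tau_y q0)
    (f g : {ratfun K}) (Hfg : partial theta_x f = partial theta_y g) :
  exists (a : {ratfun K}) (n : nat) (b : 'I_n -> {ratfun K})
         (s : 'I_n -> nat) (t : 'I_n -> int),
    [/\ f = partial theta_y a + \sum_(i < n) op_quot theta_x (s i)%:Z (b i),
        g = partial theta_x a + \sum_(i < n) op_quot theta_y (t i) (b i)
      & forall i : 'I_n,
          op_pow theta_x (s i)%:Z (b i) = op_pow theta_y (t i) (b i)
          /\ ~ (s i = 0%N /\ t i = 0)].

Proof.
(* Only the affine form of [theta_y] and the coefficients c', d' of its inverse are recorded; shift
   and q-shift in y are then treated alike. *)
have [c [d [c' [d' [c0 cc' dd' Hy]]]]] : exists c d c' d' : K,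
    [/\ c != 0, c' * c = 1, c' * d + d' = 0 & affine_y theta_y c d].
  case: Htheta_y => ->.
    exists 1, 1, 1, (- 1); split; last exact: sigma_y_affine.
    - exact: oner_neq0.
    - exact: mulr1.
    - by rewrite mulr1 addrN.
  exists q, 0, q^-1, 0; split; last exact: tau_y_affine.
  - exact: q0.
  - exact: mulVf.
  - by rewrite mulr0 addr0.
(* For [theta_x] the case is kept in the last conjunct, since it decides what remains once the
   aperiodic poles are gone: polynomials or Laurent polynomials in x. *)
have [a [b [a' [b' [a0 aa' bb' Hx Hab]]]]] : exists a b a' b' : K,
    [/\ a != 0, a' * a = 1, a' * b + b' = 0, affine_x theta_x a b
      & a = 1 /\ b = 1 \/ a = q /\ b = 0].
  case: Htheta_x => ->.
    exists 1, 1, 1, (- 1); split; [| | |exact: sigma_x_affine|by left].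
    - exact: oner_neq0.
    - exact: mulr1.
    - by rewrite mulr1 addrN.
  exists q, 0, q^-1, 0; split; [| | |exact: tau_x_affine|by right].
  - exact: q0.
  - exact: mulVf.
  - by rewrite mulr0 addr0.
have [X_zm X_mm X_tofrac] := affine_x_morph a0 Hx.
have [Y_zm Y_mm Y_tofrac] := affine_y_morph c0 Hy.
have c'0 : c' != 0 by apply: contra_eq_neq cc' => ->; rewrite mul0r eq_sym oner_neq0.
apply: (represented_sum X_zm Y_zm).
have sU (z w : K) : z != 0 -> size (frac_cst z *: 'X + (frac_cst w)%:P) = 2.
  by move=> z0; apply: size_affine; rewrite tofrac_eq0 polyC_eq0.
have eK (z w z' w' : K) : z' * z = 1 -> z' * w + w' = 0 ->
    (frac_cst z' *: 'X + (frac_cst w')%:P)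
      \Po (frac_cst z *: 'X + (frac_cst w)%:P) = 'X.
  by move=> E1 E2; apply: affine_compK; rewrite /frac_cst -!rmorphM -?rmorphD
    ?E1 ?E2 ?rmorph1 ?rmorph0.
have aa1 : a * a' = 1 by rewrite mulrC.
have ab' : a * b' + b = 0.
  by rewrite -[b]mul1r -aa' [a' * a]mulrC -mulrA -mulrDr addrC bb' mulr0.
have embU := poly_emb_affine a b.
have UxV : map_poly (comp_poly (c *: 'X + d%:P)) (a%:P *: 'X + b%:P%:P)
    = a%:P *: 'X + b%:P%:P.
  rewrite -(mul_polyC a%:P 'X) rmorphD rmorphM /= !map_polyC map_polyX /=.
  by rewrite !comp_polyC.
have sV := size_affine d c0; have sV' := size_affine d' c'0.
have VV := affine_compK cc' dd'.
case: Hab => [[a1 b1]|[aq b0]].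
  apply: (represented_shift charK X_zm X_mm Y_zm Y_mm X_tofrac Y_tofrac UxV
    sV sV' VV (sU a b a0) (eK a b a' b' aa' bb') (eK a' b' a b aa1 ab')
    embU); last exact: Hfg.
  by rewrite /frac_cst a1 b1 !rmorph1 scale1r.
apply: (represented_q X_zm X_mm Y_zm Y_mm X_tofrac Y_tofrac UxV
  sV sV' VV (sU a b a0) (eK a b a' b' aa' bb') (eK a' b' a b aa1 ab')
  embU q0 q_nroot); last exact: Hfg.
by rewrite /frac_cst aq b0 !rmorph0 addr0.
Qed.
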